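(* An optimal list of two-dimensional subalgebras of the Lie algebra $\mathfrak g$ (with respect to the action of the group $G$) is given by 1. $\langle\mathcal D+a\mathcal P^v+\mathcal W(\delta_1),\ \mathcal G+b\mathcal P^v+\mathcal W(\delta_2)\rangle$; 2. $\langle\mathcal D+a\mathcal P^v+\mathcal W(\delta_5),\ \mathcal P^t\rangle$; 3. $\langle\mathcal D+a\mathcal P^v+\mathcal W(w),\ \mathcal P^t+\mathcal W(1)\rangle$; 4. $\langle\mathcal D+a\mathcal G+b\mathcal P^v+\mathcal W(\delta_5),\ \mathcal P^x\rangle$; 5. $\langle\mathcal D+a\mathcal G+b\mathcal P^v+\mathcal W(w),\ \mathcal P^x+\mathcal W(1)\rangle$; 6. $\langle\mathcal D+a\mathcal G+\mathcal W(\delta_1),\ \mathcal P^v+\mathcal W(\delta_2)\rangle$; 7. $\langle\mathcal G+\delta_3\mathcal P^t+a\mathcal P^v+\mathcal W(\delta_1),\ \mathcal P^x+\delta_4\mathcal P^v+\mathcal W(\delta_2)\rangle$; 8. $\langle\mathcal G+\delta_5\mathcal P^t+\mathcal W(\delta_1),\ \mathcal P^v+\mathcal W(\delta_2)\rangle$; 9. $\langle\mathcal P^t+\delta_3\mathcal P^v+\mathcal W(\delta_1),\ \mathcal P^x+\delta_4\mathcal P^v+\mathcal W(\delta_2)\rangle$; 10. $\langle\mathcal P^t+\mathcal W(\delta_1),\ \mathcal P^v+\mathcal W(\delta_2)\rangle$; 11. $\langle\mathcal P^x+\mathcal W(\delta_1),\ \mathcal P^v+\mathcal W(\delta_2)\rangle$;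 12. $\langle\mathcal D+a\mathcal G+b\mathcal P^v+c\mathcal W(w),\ \mathcal W(1)\rangle$; 13. $\langle\mathcal G+\delta_5\mathcal P^t+b\mathcal P^v+c\mathcal W(w),\ \mathcal W(1)\rangle$; 14. $\langle\mathcal P^t+\delta_1\mathcal P^v+\delta_2\mathcal W(w),\ \mathcal W(1)\rangle$; 15. $\langle\mathcal P^x+\delta_1\mathcal P^v+\delta_2\mathcal W(w),\ \mathcal W(1)\rangle$; 16. $\langle\mathcal P^v+c\mathcal W(w),\ \mathcal W(1)\rangle$; 17. $\langle\mathcal W(w),\ \mathcal W(1)\rangle$; where $\delta_1,\dots,\delta_4$, $a$, $b$ and $c$ are arbitrary constants such that one of the nonzero components in each of the pairs $(\delta_1,\delta_2)$ and $(\delta_3,\delta_4)$ can be set to be equal to $1$, and $\delta_5\in\{0,1\}$. In the seventh family of subalgebras, either $a=0$ if $\delta_4\neq0$ or $\delta_1=0$ if $\delta_2\neq0$.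
   Context: $\mathfrak g$ is the maximal Lie invariance algebra of the system $u_t+uu_x+v_x=0$, $v_t+uv_x+u_x=0$, $w_t+uw_x=0$; it is spanned by the vector fields $\mathcal D=t\partial_t+x\partial_x$, $\mathcal G=t\partial_x+\partial_u$, $\mathcal P^t=\partial_t$, $\mathcal P^x=\partial_x$, $\mathcal P^v=\partial_v$ and $\mathcal W(\Omega)=\Omega(w)\partial_w$, where $\Omega$ runs through the smooth functions of $w$. $G$ is the group of point transformations $$\tilde t=T^1t+T^0,\ \tilde x=T^1x+T^1U^0t+X^0,\ \tilde u=u+U^0,\ \tilde v=v+V^0,\ \tilde w=W(w),$$ with arbitrary constants $T^0,T^1,X^0,U^0,V^0$, $T^1\ne0$, and $W$ a smooth function with $W_w\neq0$. $G$ acts on $\mathfrak g$ by pushforward of vector fields. An optimal list of subalgebras of a given dimension is a list of $G$-inequivalent subalgebras such that every subalgebra of that dimension is $G$-equivalent to one in the list. The consideration is local: a nonzero parameter function $\Omega$ is considered on an interval where it does not vanish, and transformations $w\mapsto W(w)$ are local diffeomorphisms. $\mathcal W(\delta)$ with a constant $\delta$ means $\mathcal W(\Omega)$ with the constant function $\Omega=\delta$, and $\mathcal W(w)=w\partial_w$.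
   Formalization: Families 9–11 as printed contain equivalent members. The optimal list adds: in 9, δ3=0 if δ4≠0 or δ1=0 if δ2≠0 (as in family 7); in 10 and 11, δ1,δ2∈{0,1}. Every printed subalgebra is shown equivalent to one of the restricted list in its family. *)

(* Defs.v *)
(* MathComp-Analysis; the coordinates (t, x, u, v, w) are row vectors in R^5. *)
From HB Require Import structures.
From mathcomp Require Import all_boot all_order all_algebra.
From mathcomp Require Import all_classical all_reals all_analysis.

Set Implicit Arguments.
Unset Strict Implicit.
Unset Printing Implicit Defensive.

Import Order.TTheory GRing.Theory Num.Theory.
Import numFieldNormedType.Exports.

Local Open Scope classical_set_scope.
Local Open Scope ring_scope.

Notation vfield R := ('rV[R]_5 -> 'rV[R]_5).

Section VectorFields.
Variable R : realType.
Implicit Types (I J : set R) (p : 'rV[R]_5) (X Y Z : vfield R)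
  (S : set (vfield R)).

Definition mkpt (t x u v w : R) : 'rV[R]_5 :=
  \row_(i < 5) [:: t; x; u; v; w]`_i.

Definition tc p : R := p ord0 (@Ordinal 5 0 isT).
Definition xc p : R := p ord0 (@Ordinal 5 1 isT).
Definition uc p : R := p ord0 (@Ordinal 5 2 isT).
Definition vc p : R := p ord0 (@Ordinal 5 3 isT).
Definition wc p : R := p ord0 (@Ordinal 5 4 isT).

Definition open_interval I : Prop := [/\ open I, is_interval I & I !=set0].

Definition smooth_on I (f : R -> R) : Prop :=
  forall (n : nat) (x : R), I x -> derivable (derive1n n f) x 1.

(* The functions of w are only given on an interval I, so vector fields are
   considered on R^4 x I.  They are represented by total functions, and only
   their values on [cyl I] are meaningful. *)
Definition cyl I : set 'rV[R]_5 := [set p | I (wc p)].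
Definition eq_on I X Y : Prop := forall p, cyl I p -> X p = Y p.

Definition vD : vfield R := fun p => mkpt (tc p) (xc p) 0 0 0.
Definition vG : vfield R := fun p => mkpt 0 (tc p) 1 0 0.
Definition vPt : vfield R := fun=> mkpt 1 0 0 0 0.
Definition vPx : vfield R := fun=> mkpt 0 1 0 0 0.
Definition vPv : vfield R := fun=> mkpt 0 0 0 1 0.
Definition vW (Om : R -> R) : vfield R := fun p => mkpt 0 0 0 0 (Om (wc p)).

Definition bracket X Y : vfield R :=
  fun p => 'D_(X p) Y p - 'D_(Y p) X p.

Definition algebra_g I : set (vfield R) :=
  [set X | exists (d g pt px pv : R) (Om : R -> R), smooth_on I Om /\
     eq_on I X (d *: vD + g *: vG + pt *: vPt + px *: vPx + pv *: vPv + vW Om)].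

Definition span2 I X Y : set (vfield R) :=
  [set Z | exists a b : R, eq_on I Z (a *: X + b *: Y)].

Definition independent2 I X Y : Prop :=
  forall a b : R, eq_on I (a *: X + b *: Y) 0 -> a = 0 /\ b = 0.

Definition basis2 I X Y S : Prop := independent2 I X Y /\ S = span2 I X Y.

Definition subalgebra2 I S : Prop :=
  [/\ exists X Y, basis2 I X Y S,
      S `<=` algebra_g I
    & forall X Y, S X -> S Y -> S (bracket X Y)].

(* The consideration is local: the interval is chosen so that the parameter
   functions (the w-components) of the basis elements are either identically
   zero or nowhere zero on it. *)
Definition zero_or_nonvanishing I X : Prop :=
  (forall p, cyl I p -> wc (X p) = 0) \/ (forall p, cyl I p -> wc (X p) <> 0).

Definition regular2 I S : Prop :=
  exists X Y, [/\ basis2 I X Y S, zero_or_nonvanishing I X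
                & zero_or_nonvanishing I Y].

Definition transf (T1 T0 X0 U0 V0 : R) (W : R -> R) p : 'rV[R]_5 :=
  mkpt (T1 * tc p + T0) (T1 * xc p + T1 * U0 * tc p + X0)
        (uc p + U0) (vc p + V0) (W (wc p)).

(* As I is an interval, W is automatically injective on it. *)
Definition diffeo I J (W : R -> R) : Prop :=
  [/\ smooth_on I W, forall w, I w -> derive1 W w <> 0 & W @` I = J].

Definition pushforward I (Phi : 'rV[R]_5 -> 'rV[R]_5) S : set (vfield R) :=
  [set Y | exists2 X, S X & forall p, cyl I p -> Y (Phi p) = 'D_(X p) Phi p].

(* S lives on R^4 x I and S' on R^4 x J. *)
Definition equivalent I J S S' : Prop :=
  exists (T1 T0 X0 U0 V0 : R) (W : R -> R),
    [/\ T1 <> 0, diffeo I J W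
      & S' = pushforward I (transf T1 T0 X0 U0 V0 W) S].

(* L is a set of labels; the subalgebra labelled by s is considered on every
   interval I, as [sub s I]. *)
Definition optimal_list2 (T : Type) (sub : T -> set R -> set (vfield R))
    (L : set T) : Prop :=
  [/\ forall s I, L s -> open_interval I -> subalgebra2 I (sub s I),
      forall s s' I J, L s -> L s' -> open_interval I -> open_interval J ->
        equivalent I J (sub s I) (sub s' J) -> s = s'
    & forall I S, open_interval I -> subalgebra2 I S -> regular2 I S ->
        exists s J, [/\ L s, open_interval J & equivalent I J S (sub s J)]].

End VectorFields.

Inductive item (R : Type) : Type :=
| Item1 of R & R & R & R
| Item2 of R & R
| Item3 of R
| Item4 of R & R & R
| Item5 of R & R
| Item6 of R & R & R
| Item7 of R & R & R & R & R
| Item8 of R & R & R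
| Item9 of R & R & R & R
| Item10 of R & R
| Item11 of R & R
| Item12 of R & R & R
| Item13 of R & R & R
| Item14 of R & R
| Item15 of R & R
| Item16 of R
| Item17.
Arguments Item17 {R}.

Section List.
Variable R : realType.

Definition item_family (s : item R) : nat :=
  match s with
  | Item1 _ _ _ _ => 1 | Item2 _ _ => 2 | Item3 _ => 3 | Item4 _ _ _ => 4
  | Item5 _ _ => 5 | Item6 _ _ _ => 6 | Item7 _ _ _ _ _ => 7
  | Item8 _ _ _ => 8 | Item9 _ _ _ _ => 9 | Item10 _ _ => 10
  | Item11 _ _ => 11 | Item12 _ _ _ => 12 | Item13 _ _ _ => 13
  | Item14 _ _ => 14 | Item15 _ _ => 15 | Item16 _ => 16 | Item17 => 17
  end%N.

Local Notation Wc d := (vW (fun=> d : R)).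
Local Notation Ww := (vW (fun w : R => w)).

Definition gens (s : item R) : vfield R * vfield R :=
  match s with
  | Item1 a b d1 d2 =>
      (@vD R + a *: @vPv R + Wc d1, @vG R + b *: @vPv R + Wc d2)
  | Item2 a d5 => (@vD R + a *: @vPv R + Wc d5, @vPt R)
  | Item3 a => (@vD R + a *: @vPv R + Ww, @vPt R + Wc 1)
  | Item4 a b d5 => (@vD R + a *: @vG R + b *: @vPv R + Wc d5, @vPx R)
  | Item5 a b => (@vD R + a *: @vG R + b *: @vPv R + Ww, @vPx R + Wc 1)
  | Item6 a d1 d2 => (@vD R + a *: @vG R + Wc d1, @vPv R + Wc d2)
  | Item7 a d1 d2 d3 d4 =>
      (@vG R + d3 *: @vPt R + a *: @vPv R + Wc d1,
       @vPx R + d4 *: @vPv R + Wc d2)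
  | Item8 d1 d2 d5 => (@vG R + d5 *: @vPt R + Wc d1, @vPv R + Wc d2)
  | Item9 d1 d2 d3 d4 =>
      (@vPt R + d3 *: @vPv R + Wc d1, @vPx R + d4 *: @vPv R + Wc d2)
  | Item10 d1 d2 => (@vPt R + Wc d1, @vPv R + Wc d2)
  | Item11 d1 d2 => (@vPx R + Wc d1, @vPv R + Wc d2)
  | Item12 a b c =>
      (@vD R + a *: @vG R + b *: @vPv R + c *: Ww, Wc 1)
  | Item13 b c d5 =>
      (@vG R + d5 *: @vPt R + b *: @vPv R + c *: Ww, Wc 1)
  | Item14 d1 d2 => (@vPt R + d1 *: @vPv R + d2 *: Ww, Wc 1)
  | Item15 d1 d2 => (@vPx R + d1 *: @vPv R + d2 *: Ww, Wc 1)
  | Item16 c => (@vPv R + c *: Ww, Wc 1)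
  | Item17 => (Ww, Wc 1)
  end.

Definition item_span (s : item R) (I : set R) : set (vfield R) :=
  span2 I (gens s).1 (gens s).2.

Definition bit (y : R) : Prop := y = 0 \/ y = 1.

(* One of the nonzero components of the pair (x, y) equals 1; when both are
   nonzero, [first] tells which one is chosen. *)
Definition normalized (first : bool) (x y : R) : Prop :=
  if first then x = 1 \/ (x = 0 /\ bit y) else y = 1 \/ (y = 0 /\ bit x).

(* Either a = 0 if d4 <> 0, or d1 = 0 if d2 <> 0.  If d2 and d4 are both
   nonzero, only one of a and d1 can be removed, and [killa] tells which. *)
Definition reduced (killa : bool) (a d1 d2 d4 : R) : Prop :=
  if killa then (d4 <> 0 -> a = 0) /\ (d4 = 0 -> d2 <> 0 -> d1 = 0)
  else (d2 <> 0 -> d1 = 0) /\ (d2 = 0 -> d4 <> 0 -> a = 0).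

Definition listed (c12 c34 c7 : bool) : set (item R) := fun s =>
  match s with
  | Item1 _ _ d1 d2 => normalized c12 d1 d2
  | Item2 _ d5 => bit d5
  | Item4 _ _ d5 => bit d5
  | Item6 _ d1 d2 => normalized c12 d1 d2
  | Item7 a d1 d2 d3 d4 =>
      [/\ normalized c12 d1 d2, normalized c34 d3 d4 & reduced c7 a d1 d2 d4]
  | Item8 d1 d2 d5 => normalized c12 d1 d2 /\ bit d5
  | Item9 d1 d2 d3 d4 => normalized c12 d1 d2 /\ normalized c34 d3 d4
  | Item10 d1 d2 => normalized c12 d1 d2
  | Item11 d1 d2 => normalized c12 d1 d2
  | Item13 _ _ d5 => bit d5
  | Item14 d1 d2 => normalized c12 d1 d2
  | Item15 d1 d2 => normalized c12 d1 d2
  | _ => True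
  end.

(* The normalization of the pairs leaves equivalent subalgebras in three
   families.  In family 9, T1 = 1 and U0 = s change (d3, d1) to
   (d3 - s d4, d1 - s d2), e.g. <Pt + Pv, Px + Pv> ~ <Pt, Px + Pv>.  In
   families 10 and 11, T1 and W = om w change (d1, d2) to
   (om d1 / T1, om d2), so that both nonzero components can be set to 1. *)
Definition irredundant (c7 : bool) : set (item R) := fun s =>
  match s with
  | Item9 d1 d2 d3 d4 => reduced c7 d3 d1 d2 d4
  | Item10 d1 d2 => bit d1 /\ bit d2
  | Item11 d1 d2 => bit d1 /\ bit d2
  | _ => True
  end.

End List.

(* Main.v *)
Require Import Defs.
From mathcomp Require Import all_boot all_order all_algebra.
From mathcomp Require Import all_classical all_reals all_analysis.
From mathcomp Require Import ring lra.

Set Implicit Arguments.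
Unset Strict Implicit.
Unset Printing Implicit Defensive.

Import Order.TTheory GRing.Theory Num.Theory.
Import numFieldNormedType.Exports.

Local Open Scope classical_set_scope.
Local Open Scope ring_scope.

(* A regular two-dimensional subalgebra has w-components f and g with
   f g' - g f' = l f + m g.  If f does not vanish, this is a linear first-order
   equation for g / f with respect to the antiderivative of 1 / f, and a change
   of w makes both components affine; they even become constant when they
   commute.  What remains is linear algebra on pairs of coordinate rows, and the
   families of the list are the possible pivot positions of such a pair in the
   flag d, g, pt, px, pv, w, together with the nature of the w-components.

   Pivots are preserved by the group, so equivalent items have the same pivots.
   Within a family, the change of basis and the parameters of the transformation
   are compared at a single value of w through the first-order jets of the
   w-components, since W is not known to be affine. *)

(** * Smooth functions on an interval *)

(** Affine w-components are the right target: such a pair is given by four numbers, on which affine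
    changes of w act linearly, and closure under the bracket becomes an identity between
    coefficients. What affine changes cannot do is straighten commuting nonconstant components: the
    field with component w becomes constant only through a logarithm. Such analytic changes are
    therefore made once, and the alternative obtained there (constant or noncommuting components) is
    carried through the algebra as an invariant of pairs. Regularity enters through 1 / f, whose
    antiderivative must exist on the whole interval. In the inequivalence W can really be nonaffine:
    where both w-components vanish it is arbitrary. Between affine components, however, a
    first-order jet sees only W' and W'' / W' at the base point, and a generator W(1) in both
    subalgebras makes W'' vanish there. *)

Section Smooth.
Variable R : realType.
Implicit Types (I J : set R) (f g : R -> R) (k : nat).

Lemma near_open (T : topologicalType) (A : set T) (P : T -> Prop) x :
  open A -> A x -> (forall y, A y -> P y) -> \forall y \near x, P y.
Proof. by move=> oA Ax AP; apply: filterS (open_nbhs_nbhs (conj oA Ax)). Qed.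

(** The derivative of a product contains the factors themselves, so closure properties need an
    induction on a finite order with the function generalised. Order [k] stands for [k + 1]
    derivatives. *)
Fixpoint smooth_upto I k f : Prop :=
  (forall x, I x -> derivable f x 1) /\
  (if k is k'.+1 then smooth_upto I k' (derive1 f) else True).

Lemma smooth_uptoP I f : smooth_on I f <-> forall k, smooth_upto I k f.
Proof.
split=> [sf k|sf n].
  elim: k f sf => [|k IH] f sf; split=> //; try exact: (sf 0%N).
  by apply: IH => n x Ix; rewrite -derive1Sn; exact: sf.
move: {sf}(sf n); elim: n f => [|n IH] f [df sf] x Ix; first exact: df.
by rewrite derive1Sn; exact: IH.
Qed.

Lemma smooth_onS I f : smooth_on I f ->
  (forall x, I x -> derivable f x 1) /\ smooth_on I (derive1 f).
Proof.
move=> sf; split=> [|n x Ix]; first exact: (sf 0%N).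
by rewrite -derive1Sn; exact: sf.
Qed.

Lemma derive1_is I f x : smooth_on I f -> I x -> is_derive x 1 f (derive1 f x).
Proof. by move=> /smooth_onS[df _] Ix; rewrite derive1E; exact/derivableP/df. Qed.

Lemma smooth_upto_eq I k f g : open I -> (forall x, I x -> f x = g x) ->
  smooth_upto I k f -> smooth_upto I k g.
Proof.
move=> oI; elim: k f g => [|k IH] f g fg [df sf].
  split=> // x Ix; apply: near_eq_derivable (df x Ix); exact: (near_open oI Ix fg).
split; first by move=> x Ix; apply: near_eq_derivable (df x Ix); exact: (near_open oI Ix fg).
apply: (IH (derive1 f)) sf => x Ix.
by rewrite !derive1E; apply: near_eq_derive; exact: (near_open oI Ix fg).
Qed.

(** Lets a formula [df], valid on [I] only, stand for [derive1 f]; sums, products and inverses then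
    reduce to their derivative formulas. *)
Lemma smooth_upto_is I k f df : open I -> (forall x, I x -> is_derive x 1 f (df x)) ->
  smooth_upto I k df -> smooth_upto I k.+1 f.
Proof.
move=> oI fdf sdf; split=> [x /fdf[]//|].
by apply: smooth_upto_eq sdf => // x /fdf[_]; rewrite derive1E.
Qed.

Lemma smooth_uptoW I k f : smooth_upto I k.+1 f -> smooth_upto I k f.
Proof. by elim: k f => [|k IH] f [df sf]; split=> //; exact: IH. Qed.

Lemma smooth_upto_derive I k f x : smooth_upto I k f -> I x ->
  is_derive x 1 f (derive1 f x).
Proof. by case: k => [|k] [df _] Ix; rewrite derive1E; exact/derivableP/df. Qed.

Lemma smooth_upto_cst I k (c : R) : smooth_upto I k (fun=> c).
Proof.
elim: k c => [|k IH] c /=; split; do ?[by []|by move=> x _; exact: derivable_cst].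
by rewrite (_ : derive1 _ = fun=> 0)//; apply/funext => x; rewrite derive1_cst.
Qed.

Lemma smooth_uptoD I k f g : open I ->
  smooth_upto I k f -> smooth_upto I k g -> smooth_upto I k (fun x => f x + g x).
Proof.
move=> oI; elim: k f g => [|k IH] f g sf sg.
  by split=> // x Ix; apply: derivableD; [exact: sf.1|exact: sg.1].
apply: (smooth_upto_is (df := fun x => derive1 f x + derive1 g x)) => // [x Ix|].
  by apply: is_deriveD; [exact: (smooth_upto_derive sf)|exact: (smooth_upto_derive sg)].
by apply: IH; [case: sf|case: sg].
Qed.

Lemma smooth_uptoM I k f g : open I ->
  smooth_upto I k f -> smooth_upto I k g -> smooth_upto I k (fun x => f x * g x).
Proof.
move=> oI; elim: k f g => [|k IH] f g sf sg.
  by split=> // x Ix; apply: derivableM; [exact: sf.1|exact: sg.1].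
apply: (smooth_upto_is (df := fun x => f x * derive1 g x + g x * derive1 f x)) => // [x Ix|].
  by apply: is_deriveM; [exact: (smooth_upto_derive sf)|exact: (smooth_upto_derive sg)].
by apply: smooth_uptoD => //; apply: IH; do ?exact: smooth_uptoW; [case: sg|case: sf].
Qed.

Lemma smooth_uptoV I k f : open I -> (forall x, I x -> f x != 0) ->
  smooth_upto I k f -> smooth_upto I k (fun x => (f x)^-1).
Proof.
move=> oI f0; elim: k => [|k IH] sf.
  by split=> // x Ix; apply: derivableV; [exact: f0|exact: sf.1].
have sV := IH (smooth_uptoW sf).
(* The derivative is arranged as a product, so that [sV], the claim at the previous order, and
   [smooth_uptoM] apply. *)
apply: (smooth_upto_is
  (df := fun x => -1 * ((f x)^-1 * (f x)^-1) * derive1 f x)) => // [x Ix|].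
  apply: is_derive_eq.
    by apply: is_deriveV; [exact: f0|exact: (smooth_upto_derive sf)].
  by rewrite mulN1r expr2 invfM.
apply: smooth_uptoM => //; last by case: sf.
by apply: smooth_uptoM => //; [exact: smooth_upto_cst|exact: smooth_uptoM].
Qed.

Lemma smooth_cst I (c : R) : smooth_on I (fun=> c).
Proof. by apply/smooth_uptoP => k; exact: smooth_upto_cst. Qed.

Lemma smooth_primitive I f df : open I ->
  (forall x, I x -> is_derive x 1 f (df x)) -> smooth_on I df -> smooth_on I f.
Proof.
move=> oI fdf /smooth_uptoP sdf; apply/smooth_uptoP => k.
exact/smooth_uptoW/(smooth_upto_is oI fdf).
Qed.

Lemma smooth_id I : open I -> smooth_on I id.
Proof.
by move=> oI; apply: (smooth_primitive oI (df := cst 1)); last exact: smooth_cst.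
Qed.

Lemma smoothD I f g : open I -> smooth_on I f -> smooth_on I g ->
  smooth_on I (fun x => f x + g x).
Proof.
move=> oI /smooth_uptoP sf /smooth_uptoP sg; apply/smooth_uptoP => k.
exact: smooth_uptoD.
Qed.

Lemma smoothM I f g : open I -> smooth_on I f -> smooth_on I g ->
  smooth_on I (fun x => f x * g x).
Proof.
move=> oI /smooth_uptoP sf /smooth_uptoP sg; apply/smooth_uptoP => k.
exact: smooth_uptoM.
Qed.

Lemma smoothV I f : open I -> (forall x, I x -> f x != 0) -> smooth_on I f ->
  smooth_on I (fun x => (f x)^-1).
Proof.
by move=> oI f0 /smooth_uptoP sf; apply/smooth_uptoP => k; exact: smooth_uptoV.
Qed.

Lemma smooth_affine I f (k l : R) : open I -> smooth_on I f ->
  smooth_on I (fun x => k * f x + l).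
Proof.
move=> oI sf; apply: (smoothD oI _ (@smooth_cst I l)).
exact: (smoothM oI (@smooth_cst I k) sf).
Qed.

Lemma smooth_continuous I f x : smooth_on I f -> I x -> {for x, continuous f}.
Proof.
by move=> /smooth_onS[df _] Ix; apply/differentiable_continuous/derivable1_diffP/df.
Qed.

End Smooth.

(** * Open intervals: images under smooth maps and antiderivatives *)

Section Interval.
Variable R : realType.
Implicit Types (I J : set R) (f g : R -> R).

Lemma interval_sub I a b x : open_interval I -> I a -> I b -> a <= x <= b -> I x.
Proof. by move=> [_ iI _] Ia Ib axb; exact: iI Ia Ib _ axb. Qed.

Lemma interval_ball I x : open_interval I -> I x ->
  exists2 e, 0 < e & I (x - e) /\ I (x + e).
Proof.
move=> [oI _ _] Ix; have /nbhs_ballP[e /= e0 eI] := open_nbhs_nbhs (conj oI Ix).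
(* Halving the radius puts both endpoints inside the open ball. *)
exists (e / 2); first by rewrite divr_gt0.
by split; apply: eI; rewrite /ball /= ?subKr ?opprD ?addNKr ?normrN gtr0_norm
  ?divr_gt0// ltr_pdivrMr// ltr_pMr// ltr1n.
Qed.

Lemma derive0_cst I f a b : open_interval I ->
  (forall x, I x -> is_derive x 1 f 0) -> I a -> I b -> f a = f b.
Proof.
move=> oI f0; wlog ab : a b / a <= b.
  by move=> H Ia Ib; case: (leP a b) => [/H->//|/ltW/H->].
move=> Ia Ib; have sub x : x \in `[a, b] -> I x.
  by rewrite in_itv /= => xab; exact: interval_sub Ia Ib xab.
have [||c _ /eqP] := @MVT_segment _ f (fun=> 0) a b ab.
- by move=> x xab; apply/f0/sub; exact: subset_itv_oo_cc xab.
- by apply: derivable_within_continuous => x /sub /f0[].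
- by rewrite mul0r subr_eq0 => /eqP.
Qed.

(** The image is connected, hence convex. No value is extremal, as the derivative would vanish
    there; each value thus lies strictly between two others, and convexity gives a neighbourhood. *)
Lemma smooth_image_open_interval I f : open_interval I -> smooth_on I f ->
  (forall x, I x -> derive1 f x <> 0) -> open_interval (f @` I).
Proof.
move=> oI sf f0; have [opI iI [x0 Ix0]] := oI.
have iJ : is_interval (f @` I).
  apply/connected_intervalP/connected_continuous_connected.
    exact/connected_intervalP.
  by apply: continuous_in_subspaceT => x /[!inE] Ix; exact: smooth_continuous Ix.
split=> //; last by exists (f x0), x0.
have extremal x : I x ->
    (exists2 y, I y & f x < f y) /\ (exists2 y, I y & f y < f x).
  move=> Ix; have [e e0 [Il Ir]] := interval_ball oI Ix.
  have sub y : y \in `]x - e, x + e[ -> I y.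
    by move=> /subset_itv_oo_cc; rewrite in_itv; exact: interval_sub Il Ir.
  have xin : x \in `]x - e, x + e[ by rewrite in_itv /= ltrBlDr ltrDl e0.
  have le : x - e <= x + e by rewrite lerD2l ge0_cp// ltW.
  have df t : t \in `]x - e, x + e[ -> derivable f t 1.
    by move=> /sub It; exact: (sf 0%N).
  split; apply: contrapT => H; apply: (f0 _ Ix); rewrite derive1E.
    have [//|_ ->//] := @derive1_at_max _ f _ _ x le df xin _.
    by move=> t /sub It; rewrite leNgt; apply/negP => ?; apply: H; exists t.
  have [//|_ ->//] := @derive1_at_min _ f _ _ x le df xin _.
  by move=> t /sub It; rewrite leNgt; apply/negP => ?; apply: H; exists t.
rewrite openE => _ [x Ix <-]; have [[y Iy xy] [z Iz zx]] := extremal _ Ix.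
have : nbhs (f x) [set` `]f z, f y[].
  by apply: open_nbhs_nbhs; split; [exact: interval_open|rewrite /= in_itv /= zx].
apply: filterS => t; rewrite /= in_itv /= => /andP[zt ty].
by apply: (iJ (f z) (f y)); [exists z|exists y|rewrite !ltW].
Qed.

(** The fundamental theorem of calculus is applied from a left endpoint [a] that depends on [x];
    near [x] the resulting integral differs by a constant from a primitive based at a fixed point
    [c]. *)
Lemma antiderivative I f : open_interval I -> (forall x, I x -> {for x, continuous f}) ->
  exists F, forall x, I x -> is_derive x 1 F (f x).
Proof.
move=> oI cf; have [_ _ [c Ic]] := oI.
pose S a b := (\int[lebesgue_measure]_(t in `[a, b]) f t)%R.
have int a b : I a -> I b -> lebesgue_measure.-integrable `[a, b] (EFin \o f).
  move=> Ia Ib; apply: continuous_compact_integrable; first exact: segment_compact.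
  apply: continuous_in_subspaceT => x /[!inE] /=; rewrite in_itv /= => xab.
  exact/cf/(interval_sub oI Ia Ib).
have chasles a b d : I a -> I d -> a <= b <= d -> S a d = S a b + S b d.
  move=> Ia Id /andP[ab bd]; apply/eqP; rewrite addrC -subr_eq; apply/eqP.
  rewrite /S Rintegral_itvB ?bnd_simp//; last exact: int.
  apply: Rintegral_itv_obnd_cbnd; apply: integrableS (int _ _ Ia Id) => //.
  by apply: subset_itvr; rewrite bnd_simp.
(* The integral over a set carries no orientation, so the sign to the left of [c] is put in by
   hand. *)
pose F x := if c <= x then S c x else - S x c.
exists F => x Ix; have [e e0 [Il Ir]] := interval_ball oI Ix.
pose a := Num.min c (x - e).
have Ia : I a by rewrite /a; case: ltP.
have ac : a <= c by rewrite /a ge_min lexx.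
have ax : a < x by rewrite /a gt_min ltrBlDr ltrDl e0 orbT.
have FE y : y \in `]a, x + e[ -> S a y - S a c = F y.
  rewrite in_itv /= => /andP[/ltW ay /ltW yx]; rewrite /F; case: (leP c y) => cy.
    by rewrite (chasles a c y) ?ac//; [ring|apply: interval_sub oI Ia Ir _; rewrite ay].
  by rewrite (chasles a y c) ?ay ?ltW//; ring.
apply: (@near_eq_is_derive _ _ _ (fun y => S a y - S a c)).
  have : nbhs x [set` `]a, x + e[].
    by apply: open_nbhs_nbhs; split; [exact: interval_open|rewrite /= in_itv /= ax ltrDl].
  by apply: filterS => y; exact: FE.
have [dS S'] := @continuous_FTC1_closed _ f a x (x + e) (ltac:(by rewrite ltrDl))
  (int _ _ Ia Ir) ax (cf _ Ix).
rewrite -[f x]subr0; apply: is_deriveB.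
by rewrite -S' derive1E; exact: derivableP.
Qed.

End Interval.

(** * Rectification of the w-components *)

Section Rectify.
Variable R : realType.
Implicit Types (I J : set R) (f g W : R -> R).

(** [derive1 W x * f x] is the component of the pushed-forward field at [W x]. The determinant is,
    up to sign, the constant component of the bracket of the two affine fields. *)
Definition rectifies I f g W (A1 B1 A2 B2 : R) : Prop :=
  [/\ smooth_on I W, forall x, I x -> derive1 W x <> 0,
      forall x, I x -> derive1 W x * f x = A1 * W x + B1,
      forall x, I x -> derive1 W x * g x = A2 * W x + B2
    & (A1 = 0 /\ A2 = 0) \/ A1 * B2 - A2 * B1 <> 0].

Lemma derive1_val f x df : is_derive x (1 : R) f df -> derive1 f x = df.
Proof. by move=> [_]; rewrite derive1E. Qed.

(* For q = g / f one has q' = (l + m q) / f.  If m = 0 or l + m q = 0, take for W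
   the antiderivative W0 of 1 / f.  Otherwise Z = l + m q satisfies Z' = m Z / f,
   so it is a multiple of exp (m W0) and vanishes nowhere; take W = 1 / Z. *)
Lemma rectify_nonvanishing I f g (l m : R) : open_interval I ->
  smooth_on I f -> smooth_on I g -> (forall x, I x -> f x != 0) ->
  (forall x, I x -> f x * derive1 g x - g x * derive1 f x = l * f x + m * g x) ->
  exists W A1 B1 A2 B2, rectifies I f g W A1 B1 A2 B2.
Proof.
move=> oI sf sg f0 fg; have [opI _ [c Ic]] := oI.
have sV := smoothV opI f0 sf.
have [W0 dW0] := antiderivative oI (fun x => smooth_continuous sV).
have sW0 := smooth_primitive opI dW0 sV.
pose q x := g x * (f x)^-1.
have gq x : I x -> g x = q x * f x by move=> Ix; rewrite /q divfK ?f0.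
have sq : smooth_on I q by exact: smoothM.
have dq x : I x -> is_derive x 1 q ((l + m * q x) / f x).
  move=> Ix; apply: is_derive_eq.
    apply: is_deriveM; first exact: derive1_is sg Ix.
    by apply: is_deriveV; [exact: f0|exact: derive1_is sf Ix].
  rewrite /GRing.scale /= /q.
  transitivity ((f x * derive1 g x - g x * derive1 f x) / (f x ^+ 2)).
    by field; exact: f0.
  by rewrite fg //; field; exact: f0.
have W0f x : I x -> derive1 W0 x * f x = 1.
  by move=> Ix; rewrite (derive1_val (dW0 _ Ix)) mulVf ?f0.
have W00 x : I x -> derive1 W0 x <> 0.
  by move=> Ix; rewrite (derive1_val (dW0 _ Ix)); apply/eqP; rewrite invr_eq0 f0.
have W0g x : I x -> derive1 W0 x * g x = q x.
  by move=> Ix; rewrite (gq _ Ix) mulrCA W0f ?mulr1.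
have [Z0|/existsNP[x1 /not_implyP[Ix1 Zx1]]] :=
    EM (forall x, I x -> l + m * q x = 0).
  exists W0, 0, 1, 0, (q c); split=> // [x Ix|x Ix|]; last by left.
    by rewrite W0f// mul0r add0r.
  rewrite W0g// mul0r add0r; apply: (derive0_cst oI) => // y Iy.
  by apply: is_derive_eq (dq _ Iy) _; rewrite Z0// mul0r.
have [m0|m0] := eqVneq m 0.
  rewrite m0 mul0r addr0 in Zx1.
  have k x : I x -> q x - l * W0 x = q c - l * W0 c.
    move=> Ix; apply: (derive0_cst oI (f := fun x => q x - l * W0 x)) => // y Iy.
    apply: is_derive_eq.
      by apply: is_deriveB; [exact: dq|apply: is_deriveZ; exact: dW0].
    by rewrite m0 mul0r addr0 /GRing.scale /= subrr.
  exists W0, 0, 1, l, (q c - l * W0 c); split=> // [x Ix|x Ix|].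
  - by rewrite W0f// mul0r add0r.
  - by rewrite W0g// -(k x Ix) addrC subrK.
  - by right; rewrite mul0r sub0r mulr1; move/eqP; rewrite oppr_eq0 => /eqP.
pose Z x := m * q x + l.
have sZ : smooth_on I Z by exact: smooth_affine.
have dZ x : I x -> is_derive x 1 Z (m * Z x / f x).
  move=> Ix; apply: is_derive_eq.
    by apply: is_deriveD; apply: is_deriveZ; exact: dq.
  by rewrite /Z addr0 /GRing.scale /= mulrA [l + _]addrC.
have Z0 x : I x -> Z x != 0.
  move=> Ix; pose E x := expR (- m * W0 x).
  have dE y : I y -> is_derive y 1 E (E y * (- m * (f y)^-1)).
    move=> Iy; apply: (@is_derive1_comp _ expR (fun x => - m * W0 x)).
    by apply: is_deriveZ; exact: dW0.
  have ZE : Z x * E x = Z x1 * E x1.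
    apply: (derive0_cst oI (f := fun x => Z x * E x)) => // y Iy.
    apply: is_derive_eq; first by apply: is_deriveM; [exact: dZ|exact: dE].
    by rewrite /GRing.scale /=; ring.
  have : Z x * E x != 0.
    rewrite ZE mulf_neq0 //; last exact/lt0r_neq0/expR_gt0.
    by apply/eqP; rewrite /Z [_ + l]addrC.
  by rewrite mulf_eq0 negb_or => /andP[].
have dW x : I x -> is_derive x 1 (fun x => (Z x)^-1) (- m / (Z x * f x)).
  move=> Ix; apply: is_derive_eq.
    by apply: is_deriveV; [exact: Z0|exact: dZ].
  by rewrite /GRing.scale /=; field; rewrite Z0// f0.
(* With W = 1 / Z: W' f = - m / Z = - m W and W' g = - m q / Z = (l - Z) / Z = l W - 1. *)
exists (fun x => (Z x)^-1), (- m), 0, l, (- 1); split=> [|x Ix|x Ix|x Ix|].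
- exact: smoothV.
- rewrite (derive1_val (dW _ Ix)); apply/eqP.
  by rewrite mulf_neq0// ?oppr_eq0// invr_neq0// mulf_neq0 ?Z0 ?f0.
- by rewrite (derive1_val (dW _ Ix)); field; rewrite Z0// f0.
- rewrite (derive1_val (dW _ Ix)) (gq _ Ix).
  have -> : l = Z x - m * q x by rewrite /Z; ring.
  by field; rewrite Z0// f0.
- by right; rewrite mulr0 subr0 mulrN1 opprK; apply/eqP.
Qed.

Lemma rectify I f g (l m : R) : open_interval I ->
  smooth_on I f -> smooth_on I g ->
  (forall x, I x -> f x = 0) \/ (forall x, I x -> f x != 0) ->
  (forall x, I x -> g x = 0) \/ (forall x, I x -> g x != 0) ->
  (forall x, I x -> f x * derive1 g x - g x * derive1 f x = l * f x + m * g x) ->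
  exists W A1 B1 A2 B2, rectifies I f g W A1 B1 A2 B2.
Proof.
move=> oI sf sg [f0|f0]; last by move=> _; exact: rectify_nonvanishing.
case=> [g0|g0] fg.
  have [opI _ _] := oI; exists id, 0, 0, 0, 0; split=> [|x Ix|x Ix|x Ix|].
  - exact: smooth_id.
  - by rewrite derive1_id; apply/eqP; exact: oner_neq0.
  - by rewrite f0// mulr0 mul0r addr0.
  - by rewrite g0// mulr0 mul0r addr0.
  - by left.
(* Exchanging [f] and [g] negates the left-hand side, hence the coefficients [- m] and [- l]. *)
have [|W [A1 [B1 [A2 [B2 [sW W0 Wg Wf AB]]]]]] :=
    @rectify_nonvanishing _ g f (- m) (- l) oI sg sf g0.
  by move=> x Ix; move: (fg x Ix) => H; apply: oppr_inj; rewrite opprB H; ring.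
exists W, A2, B2, A1, B1; split=> //; case: AB => [[]|AB]; [by left|right].
by move=> H; apply: AB; apply: oppr_inj; rewrite opprB H oppr0.
Qed.

End Rectify.

(** * Coordinate rows *)

(* Coords d g p x v A B stands for d D + g G + p Pt + x Px + v Pv + W(A w + B). *)
Record coords (R : Type) := Coords { rd : R; rg : R; rp : R; rx : R; rv : R; rA : R; rB : R }.

Section Rows.
Variable R : realType.
Implicit Types (r : coords R) (c : bool).

Definition lin (a : R) r (b : R) (s : coords R) : coords R :=
  Coords (a * rd r + b * rd s) (a * rg r + b * rg s) (a * rp r + b * rp s)
      (a * rx r + b * rx s) (a * rv r + b * rv s) (a * rA r + b * rA s)
      (a * rB r + b * rB s).

(* The pushforward by transf T1 T0 X0 U0 V0 (fun w => k * w + l). *)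
Definition act (T1 T0 X0 U0 k l : R) r : coords R :=
  Coords (rd r) (rg r) (T1 * rp r - T0 * rd r)
      (T1 * rx r + T1 * U0 * rp r - X0 * rd r - T0 * rg r) (rv r)
      (rA r) (k * rB r - l * rA r).

Definition coords_bracket r (s : coords R) : coords R :=
  Coords 0 0 (rd s * rp r - rd r * rp s)
      (rd s * rx r - rd r * rx s + (rg s * rp r - rg r * rp s)) 0
      0 (rB r * rA s - rA r * rB s).

(** The algebraic form of equivalence. Only affine changes of w occur: the nonaffine ones are spent
    in [rectify]. *)
Definition eqv r1 r2 r1' r2' : Prop :=
  exists T1 T0 X0 U0 k l a b c d : R,
    [/\ T1 <> 0, k <> 0, a * d - b * c <> 0,
        lin a (act T1 T0 X0 U0 k l r1) b (act T1 T0 X0 U0 k l r2) = r1'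
      & lin c (act T1 T0 X0 U0 k l r1) d (act T1 T0 X0 U0 k l r2) = r2'].

Ltac coords_ring := rewrite /lin /act /coords_bracket /=; congr Coords; ring.

Lemma eqv_trans r1 r2 r1' r2' r1'' r2'' :
  eqv r1 r2 r1' r2' -> eqv r1' r2' r1'' r2'' -> eqv r1 r2 r1'' r2''.
Proof.
move=> [T1 [T0 [X0 [U0 [k [l [a [b [c [d [T10 k0 D0 <- <-]]]]]]]]]]].
move=> [T1' [T0' [X0' [U0' [k' [l' [a' [b' [c' [d' [T10' k0' D0' <- <-]]]]]]]]]]].
exists (T1' * T1), (T1' * T0 + T0'), (T1' * X0 + T1' * U0' * T0 + X0'), (U0 + U0').
exists (k' * k), (k' * l + l').
exists (a' * a + b' * c), (a' * b + b' * d), (c' * a + d' * c), (c' * b + d' * d).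
split; try coords_ring; apply/eqP; rewrite ?mulf_neq0//; try exact/eqP.
rewrite (_ : _ - _ = (a' * d' - b' * c') * (a * d - b * c)); last by ring.
by rewrite mulf_neq0//; exact/eqP.
Qed.

Definition coords0 : coords R := Coords 0 0 0 0 0 0 0.

Definition indep_coords r1 r2 : Prop :=
  forall a b : R, lin a r1 b r2 = coords0 -> a = 0 /\ b = 0.

(* Changes of basis and affine changes of w cannot make commuting nonconstant
   components constant, hence good_rect. *)
Record good r1 r2 : Prop := Good {
  good_indep : indep_coords r1 r2;
  good_closed : exists l m : R, coords_bracket r1 r2 = lin l r1 m r2;
  good_rect : (rA r1 = 0 /\ rA r2 = 0) \/ rA r1 * rB r2 - rA r2 * rB r1 <> 0 }.

(** The action is invertible and commutes with brackets; a change of basis multiplies the bracket by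
    its determinant, and the determinant in [good_rect] is multiplied by [k * (a * d - b * c)]. *)
Lemma eqv_good r1 r2 r1' r2' : eqv r1 r2 r1' r2' -> good r1 r2 -> good r1' r2'.
Proof.
move=> [T1 [T0 [X0 [U0 [k [l [a [b [c [d [T10 k0 D0 <- <-]]]]]]]]]]].
move=> [ind [y [z cl]] rect]; split.
- move=> e f H.
  have comb u v : lin e (lin a u b v) f (lin c u d v) =
      lin (e * a + f * c) u (e * b + f * d) v by coords_ring.
  have [e1 e2] : e * a + f * c = 0 /\ e * b + f * d = 0.
    apply: ind; move: H; rewrite comb; move: (e * a + _) (e * b + _) => {comb} u v.
    (* The action is triangular: [H1] and [H2] clear the corrections in the Pt coordinate and then,
       with Pt, in the Px coordinate. *)
    rewrite /lin /act /= => -[H1 H2 H3 H4 H5 H6 H7]; congr Coords => //.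
    - apply: (mulfI (introN eqP T10)); rewrite mulr0 -H3.
      transitivity (T1 * (u * rp r1 + v * rp r2) - T0 * (u * rd r1 + v * rd r2)).
        by rewrite H1; ring.
      by ring.
    - have H3' : u * rp r1 + v * rp r2 = 0.
        apply: (mulfI (introN eqP T10)); rewrite mulr0 -H3.
        transitivity (T1 * (u * rp r1 + v * rp r2) - T0 * (u * rd r1 + v * rd r2)).
          by rewrite H1; ring.
        by ring.
      apply: (mulfI (introN eqP T10)); rewrite mulr0 -H4.
      transitivity (T1 * (u * rx r1 + v * rx r2) + T1 * U0 * (u * rp r1 + v * rp r2)
        - X0 * (u * rd r1 + v * rd r2) - T0 * (u * rg r1 + v * rg r2)).
        by rewrite H1 H2 H3'; ring.
      by ring.
    - apply: (mulfI (introN eqP k0)); rewrite mulr0 -H7.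
      transitivity (k * (u * rB r1 + v * rB r2) - l * (u * rA r1 + v * rA r2)).
        by rewrite H6; ring.
      by ring.
  split; apply: (mulIf (introN eqP D0)); rewrite mul0r.
    transitivity ((e * a + f * c) * d - (e * b + f * d) * c); first by ring.
    by rewrite e1 e2; ring.
  transitivity ((e * b + f * d) * a - (e * a + f * c) * b); first by ring.
  by rewrite e1 e2; ring.
- exists (y * d - z * c), (z * a - y * b).
  transitivity (lin (a * d - b * c) (act T1 T0 X0 U0 k l (coords_bracket r1 r2)) 0 coords0).
    by coords_ring.
  by rewrite cl; coords_ring.
- case: rect => [[A1 A2]|rect]; first by left; rewrite /lin /act /= A1 A2; split; ring.
  right; rewrite /lin /act /=.
  rewrite (_ : _ - _ = k * (a * d - b * c) * (rA r1 * rB r2 - rA r2 * rB r1)); last by ring.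
  by apply/eqP; rewrite !mulf_neq0//; exact/eqP.
Qed.

Definition item_coords (s : item R) : coords R * coords R :=
  match s with
  | Item1 a b d1 d2 => (Coords 1 0 0 0 a 0 d1, Coords 0 1 0 0 b 0 d2)
  | Item2 a d5 => (Coords 1 0 0 0 a 0 d5, Coords 0 0 1 0 0 0 0)
  | Item3 a => (Coords 1 0 0 0 a 1 0, Coords 0 0 1 0 0 0 1)
  | Item4 a b d5 => (Coords 1 a 0 0 b 0 d5, Coords 0 0 0 1 0 0 0)
  | Item5 a b => (Coords 1 a 0 0 b 1 0, Coords 0 0 0 1 0 0 1)
  | Item6 a d1 d2 => (Coords 1 a 0 0 0 0 d1, Coords 0 0 0 0 1 0 d2)
  | Item7 a d1 d2 d3 d4 => (Coords 0 1 d3 0 a 0 d1, Coords 0 0 0 1 d4 0 d2)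
  | Item8 d1 d2 d5 => (Coords 0 1 d5 0 0 0 d1, Coords 0 0 0 0 1 0 d2)
  | Item9 d1 d2 d3 d4 => (Coords 0 0 1 0 d3 0 d1, Coords 0 0 0 1 d4 0 d2)
  | Item10 d1 d2 => (Coords 0 0 1 0 0 0 d1, Coords 0 0 0 0 1 0 d2)
  | Item11 d1 d2 => (Coords 0 0 0 1 0 0 d1, Coords 0 0 0 0 1 0 d2)
  | Item12 a b c => (Coords 1 a 0 0 b c 0, Coords 0 0 0 0 0 0 1)
  | Item13 b c d5 => (Coords 0 1 d5 0 b c 0, Coords 0 0 0 0 0 0 1)
  | Item14 d1 d2 => (Coords 0 0 1 0 d1 d2 0, Coords 0 0 0 0 0 0 1)
  | Item15 d1 d2 => (Coords 0 0 0 1 d1 d2 0, Coords 0 0 0 0 0 0 1)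
  | Item16 c => (Coords 0 0 0 0 1 c 0, Coords 0 0 0 0 0 0 1)
  | Item17 => (Coords 0 0 0 0 0 1 0, Coords 0 0 0 0 0 0 1)
  end.

(** * Normalization of the parameters within a family *)

Section Normalization.
Variables c12 c34 c7 : bool.

(** The family number is recorded because the last clause of the theorem replaces an item by one of
    its own family. *)
Definition reaches (n : nat) r1 r2 : Prop :=
  exists s, [/\ listed c12 c34 c7 s, irredundant c7 s, item_family s = n
              & eqv r1 r2 (item_coords s).1 (item_coords s).2].

Lemma reaches_eqv n r1 r2 r1' r2' :
  eqv r1 r2 r1' r2' -> reaches n r1' r2' -> reaches n r1 r2.
Proof. by move=> e [s [? ? ? e']]; exists s; split=> //; exact: eqv_trans e'. Qed.

Lemma reaches_item (s : item R) (T1 T0 X0 U0 k l a b c d : R) r1 r2 :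
  listed c12 c34 c7 s -> irredundant c7 s ->
  T1 != 0 -> k != 0 -> a * d - b * c != 0 ->
  lin a (act T1 T0 X0 U0 k l r1) b (act T1 T0 X0 U0 k l r2) = (item_coords s).1 ->
  lin c (act T1 T0 X0 U0 k l r1) d (act T1 T0 X0 U0 k l r2) = (item_coords s).2 ->
  reaches (item_family s) r1 r2.
Proof.
move=> ? ? /eqP? /eqP? /eqP? ? ?; exists s; split=> //.
by exists T1, T0, X0, U0, k, l, a, b, c, d.
Qed.

Lemma bit_scale (x : R) : exists2 k, k != 0 & bit (k * x).
Proof.
have [->|x0] := eqVneq x 0; first by exists 1; [exact: oner_neq0|left; rewrite mulr0].
by exists x^-1; [rewrite invr_neq0|right; rewrite mulVf].
Qed.

Lemma normalized_scale c (x y : R) : exists2 k, k != 0 & normalized c (k * x) (k * y).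
Proof.
case: c => /=.
  have [->|x0] := eqVneq x 0.
    by have [k k0 yk] := bit_scale y; exists k => //; right; rewrite mulr0.
  by exists x^-1; [rewrite invr_neq0|left; rewrite mulVf].
have [->|y0] := eqVneq y 0.
  by have [k k0 yk] := bit_scale x; exists k => //; right; rewrite mulr0.
by exists y^-1; [rewrite invr_neq0|left; rewrite mulVf].
Qed.

(** For family 7: [T1 = t] multiplies [d3] by t, whereas restoring the coefficient of Px divides
    [d4] by t, so the product of [d3] and [d4] is invariant. *)
Lemma normalized_hyperbolic c (x y : R) :
  exists2 k, k != 0 & normalized c (k * x) (k^-1 * y).
Proof.
case: c => /=.
  have [->|x0] := eqVneq x 0.
    have [k k0 yk] := bit_scale y; exists k^-1; first by rewrite invr_neq0.
    by right; rewrite mulr0 invrK.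
  by exists x^-1; [rewrite invr_neq0|left; rewrite mulVf].
have [->|y0] := eqVneq y 0.
  by have [k k0 yk] := bit_scale x; exists k => //; right; rewrite mulr0.
by exists y => //; left; rewrite mulVf.
Qed.

Lemma normalized_bits c (x y : R) : bit x -> bit y -> normalized c x y.
Proof. by case: c => -[->|->] [->|->] /=; rewrite /bit; tauto. Qed.

(** Here [s] is the multiple of the second generator added to the first. The Px that it brings in
    can be removed by a time translation in family 7 and by a Galilean boost in family 9. *)
Lemma reduced_shift c (a d1 d2 d4 : R) :
  exists s, reduced c (a + s * d4) (d1 + s * d2) d2 d4.
Proof.
have [->|d40] := eqVneq d4 0; have [->|d20] := eqVneq d2 0.
- by exists 0; case: c; split.
- by exists (- d1 / d2); rewrite divfK// subrr; case: c; split.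
- by exists (- a / d4); rewrite divfK// subrr; case: c; split.
case: c.
  exists (- a / d4); rewrite divfK// subrr; split=> // d40'.
  by rewrite d40' eqxx in d40.
exists (- d1 / d2); rewrite divfK// subrr; split=> // d20'.
by rewrite d20' eqxx in d20.
Qed.

Lemma reduced_scale c (a d1 d2 d4 k m n p : R) : k != 0 -> m != 0 -> n != 0 ->
  p != 0 -> reduced c a d1 d2 d4 -> reduced c (k * a) (m * d1) (n * d2) (p * d4).
Proof.
move=> k0 m0 n0 p0.
have E (x y : R) : x != 0 -> (x * y = 0) = (y = 0).
  move=> x0; apply/propext; split=> [/eqP|->]; last by rewrite mulr0.
  by rewrite mulf_eq0 (negPf x0) => /eqP.
by case: c => /=; rewrite !E.
Qed.

Lemma reaches9 (d1 d2 d3 d4 : R) :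
  reaches 9 (Coords 0 0 1 0 d3 0 d1) (Coords 0 0 0 1 d4 0 d2).
Proof.
have [s rs] := reduced_shift c7 d3 d1 d2 d4.
have [t t0 nt] := normalized_scale c34 (d3 + s * d4) d4.
have [k k0 nk] := normalized_scale c12 (d1 + s * d2) d2.
(* [U0 = - s] cancels the Px brought in by the shift; the row factor [t] compensates [T1 = 1 / t],
   and [k / t] leaves the factor [k] on the w-components. *)
apply: (@reaches_item (Item9 (k * (d1 + s * d2)) (k * d2) (t * (d3 + s * d4)) (t * d4))
  t^-1 0 0 (- s) (k / t) 0 t (t * s) 0 t).
- by split.
- exact: reduced_scale.
- by rewrite invr_neq0.
- by rewrite mulf_neq0 ?invr_neq0.
- by rewrite mulr0 subr0 mulf_neq0.
- by rewrite /lin /act /=; congr Coords; field.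
- by rewrite /lin /act /=; congr Coords; field.
Qed.

Lemma reaches10 (d1 d2 : R) : reaches 10 (Coords 0 0 1 0 0 0 d1) (Coords 0 0 0 0 1 0 d2).
Proof.
have [k k0 bk] := bit_scale d2; have [t t0 bt] := bit_scale (k * d1).
apply: (@reaches_item (Item10 (t * (k * d1)) (k * d2)) t^-1 0 0 0 k 0 t 0 0 1).
- exact: normalized_bits.
- by split.
- by rewrite invr_neq0.
- by [].
- by rewrite mulr0 subr0 mulr1.
- by rewrite /lin /act /=; congr Coords; field.
- by rewrite /lin /act /=; congr Coords; field.
Qed.

Lemma reaches11 (d1 d2 : R) : reaches 11 (Coords 0 0 0 1 0 0 d1) (Coords 0 0 0 0 1 0 d2).
Proof.
have [k k0 bk] := bit_scale d2; have [t t0 bt] := bit_scale (k * d1).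
apply: (@reaches_item (Item11 (t * (k * d1)) (k * d2)) t^-1 0 0 0 k 0 t 0 0 1).
- exact: normalized_bits.
- by split.
- by rewrite invr_neq0.
- by [].
- by rewrite mulr0 subr0 mulr1.
- by rewrite /lin /act /=; congr Coords; field.
- by rewrite /lin /act /=; congr Coords; field.
Qed.

Lemma reaches7 (a d1 d2 d3 d4 : R) :
  reaches 7 (Coords 0 1 d3 0 a 0 d1) (Coords 0 0 0 1 d4 0 d2).
Proof.
have [s rs] := reduced_shift c7 a d1 d2 d4.
have [t t0 nt] := normalized_hyperbolic c34 d3 d4.
have [k k0 nk] := normalized_scale c12 (d1 + s * d2) (t^-1 * d2).
(* [T0 = t * s] acts through G and cancels the Px brought in by adding [s] times the second row. *)
apply: (@reaches_item (Item7 (a + s * d4) (k * (d1 + s * d2)) (k * (t^-1 * d2))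
  (t * d3) (t^-1 * d4)) t (t * s) 0 0 k 0 1 s 0 t^-1).
- split=> //; rewrite -[a + _]mul1r mulrA.
  by apply: reduced_scale; rewrite ?oner_neq0 ?mulf_neq0 ?invr_neq0.
- by [].
- by [].
- by [].
- by rewrite mulr0 subr0 mul1r invr_neq0.
- by rewrite /lin /act /=; congr Coords; field.
- by rewrite /lin /act /=; congr Coords; field.
Qed.

End Normalization.
End Rows.

(** * Classification of pairs of coordinate rows *)

Section Classification.
Variable R : realType.
Variables c12 c34 c7 : bool.
Implicit Types (r : coords R).

Local Notation reaches := (@reaches R c12 c34 c7).

Definition classified r1 r2 : Prop := good r1 r2 -> exists n, reaches n r1 r2.

Lemma classified_eqv r1 r2 r1' r2' :
  eqv r1 r2 r1' r2' -> classified r1' r2' -> classified r1 r2.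
Proof. by move=> e cl /(eqv_good e)/cl[n re]; exists n; exact: reaches_eqv re. Qed.

Lemma eqv_lin (a b c d : R) r1 r2 : a * d - b * c != 0 ->
  eqv r1 r2 (lin a r1 b r2) (lin c r1 d r2).
Proof.
move=> /eqP D; exists 1, 0, 0, 0, 1, 0, a, b, c, d; split=> //; try exact/eqP/oner_neq0.
- by rewrite /lin /act /=; congr Coords; ring.
- by rewrite /lin /act /=; congr Coords; ring.
Qed.

Lemma eqv_act (T1 T0 X0 U0 k l : R) r1 r2 : T1 != 0 -> k != 0 ->
  eqv r1 r2 (act T1 T0 X0 U0 k l r1) (act T1 T0 X0 U0 k l r2).
Proof.
move=> /eqP ? /eqP ?; exists T1, T0, X0, U0, k, l, 1, 0, 0, 1; split=> //.
- by rewrite mulr0 subr0 mulr1; exact/eqP/oner_neq0.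
- by rewrite /lin /act /=; congr Coords; ring.
- by rewrite /lin /act /=; congr Coords; ring.
Qed.

(** One step of row reduction in an arbitrary linear coordinate. The new rows stay in the form
    [lin], so that coordinates already known to vanish can be computed away. *)
Lemma classified_pivot (pr : coords R -> R) r1 r2 :
  (forall a r b s, pr (lin a r b s) = a * pr r + b * pr s) ->
  ~ (pr r1 = 0 /\ pr r2 = 0) ->
  (forall a b c d, pr (lin a r1 b r2) = 1 -> pr (lin c r1 d r2) = 0 ->
     classified (lin a r1 b r2) (lin c r1 d r2)) ->
  classified r1 r2.
Proof.
move=> prE nz H; have [r10|r10] := eqVneq (pr r1) 0.
  have r20 : pr r2 != 0 by apply/eqP => r20; exact: nz.
  apply: (classified_eqv (@eqv_lin 0 (pr r2)^-1 1 0 _ _ _)).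
    by rewrite mulr0 sub0r mulr1 oppr_eq0 invr_neq0.
  by apply: H; rewrite prE r10; field.
apply: (classified_eqv (@eqv_lin (pr r1)^-1 0 (- pr r2 / pr r1) 1 _ _ _)).
  by rewrite mul0r subr0 mulr1 invr_neq0.
by apply: H; rewrite prE; field.
Qed.

Ltac coords_field :=
  rewrite /lin /act /=; congr Coords; field; do ?[by [] | apply/andP; split].

Ltac nonzero := rewrite ?mulr0 ?subr0 ?mul1r;
  do ?[by rewrite ?oner_neq0 | apply: mulf_neq0 | rewrite invr_neq0].

Ltac reach_tac := solve [by nonzero | by coords_field].

(** If [A2] were nonzero, closure would give m = 0, so the w-components would commute, which
    [good_rect] allows for constant components only. *)
Lemma pure_W_second r1 (A2 B2 l m : R) :
  good r1 (Coords 0 0 0 0 0 A2 B2) ->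
  coords_bracket r1 (Coords 0 0 0 0 0 A2 B2) = lin l r1 m (Coords 0 0 0 0 0 A2 B2) ->
  l = 0 -> A2 = 0 /\ B2 != 0.
Proof.
move=> [ind _ rect] + l0; rewrite /coords_bracket /lin /= l0 => -[_ _ _ _ _ HA HB].
have A20 : A2 = 0.
  apply/eqP/negP => /negP A20.
  have m0 : m = 0 by apply: (mulIf A20); rewrite mul0r; lra.
  case: rect => /=; first by case=> _ /eqP; rewrite (negPf A20).
  by apply; rewrite m0 in HB; lra.
split=> //; apply/eqP => B20.
have [|_ /eqP] := ind 0 1; last by rewrite oner_eq0.
by rewrite A20 B20 /lin /coords0 /=; congr Coords; ring.
Qed.

(** Brackets have no D coordinate, so l = 0 and the second row is an eigenvector of the bracket with
    the first. Its leading coordinate fixes the eigenvalue m: 0 for G and Pv, -1 for Pt and Px. For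
    m = -1 a nonzero [B2] forces [A1 = 1], the origin of W(w) in families 3 and 5. *)
Lemma classified_D (g1 v1 A1 B1 g2 p2 x2 v2 A2 B2 : R) :
  classified (Coords 1 g1 0 0 v1 A1 B1) (Coords 0 g2 p2 x2 v2 A2 B2).
Proof.
move=> G; have [ind [l [m cl]] rect] := G.
have := cl; rewrite /coords_bracket /lin /= => -[Ed Eg Ep Ex Ev EA EB].
have l0 : l = 0 by lra.
rewrite l0 in Eg Ep Ex Ev EA EB.
have [g20|g20] := eqVneq g2 0; last first.
  have m0 : m = 0 by apply: (mulIf g20); rewrite mul0r; lra.
  rewrite m0 in Ep Ex Ev EA EB.
  have p20 : p2 = 0 by lra.
  have x20 : x2 = 0 by rewrite p20 in Ex; lra.
  have [A10 A20] : A1 = 0 /\ A2 = 0 by case: rect => //= -[]; lra.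
  have [k k0 nk] := normalized_scale c12 (B1 - g1 / g2 * B2) (B2 / g2).
  exists 1%N; apply: (@reaches_item _ _ _ _
    (Item1 (v1 - g1 / g2 * v2) (v2 / g2) (k * (B1 - g1 / g2 * B2)) (k * (B2 / g2)))
    1 0 0 0 k 0 1 (- g1 / g2) 0 g2^-1) => //; rewrite ?p20 ?x20 ?A10 ?A20;
    reach_tac.
subst g2.
have [p20|p20] := eqVneq p2 0; last first.
  have m1 : m = -1 by apply: (mulIf p20); rewrite mulN1r; lra.
  rewrite m1 in Ex Ev EA EB.
  have g10 : g1 = 0 by apply: (mulIf p20); rewrite mul0r; lra.
  have v20 : v2 = 0 by lra.
  have A20 : A2 = 0 by lra.
  subst g1 v2 A2.
  have [B20|B20] := eqVneq B2 0.
    have A10 : A1 = 0 by case: rect => /= [[]//|[]]; rewrite B20; ring.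
    have [k k0 nk] := bit_scale B1.
    exists 2%N; apply: (@reaches_item _ _ _ _ (Item2 v1 (k * B1))
      1 0 0 (- x2 / p2) k 0 1 0 0 p2^-1) => //; rewrite ?B20 ?A10;
    reach_tac.
  have A11 : A1 = 1 by apply: (mulIf B20); lra.
  (* [k] makes the second w-component 1 once its row is divided by [p2]; the translation [l] of w
     removes [B1]. *)
  exists 3%N; apply: (@reaches_item _ _ _ _ (Item3 v1)
      1 0 0 (- x2 / p2) (p2 / B2) (B1 * p2 / B2) 1 0 0 p2^-1) => //; rewrite ?A11;
    reach_tac.
subst p2.
have [x20|x20] := eqVneq x2 0; last first.
  have m1 : m = -1 by apply: (mulIf x20); rewrite mulN1r; lra.
  rewrite m1 in Ex Ev EA EB.
  have v20 : v2 = 0 by lra.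
  have A20 : A2 = 0 by lra.
  subst v2 A2.
  have [B20|B20] := eqVneq B2 0.
    have A10 : A1 = 0 by case: rect => /= [[]//|[]]; rewrite B20; ring.
    have [k k0 nk] := bit_scale B1.
    exists 4%N; apply: (@reaches_item _ _ _ _ (Item4 g1 v1 (k * B1))
      1 0 0 0 k 0 1 0 0 x2^-1) => //; rewrite ?B20 ?A10;
    reach_tac.
  have A11 : A1 = 1 by apply: (mulIf B20); lra.
  exists 5%N; apply: (@reaches_item _ _ _ _ (Item5 g1 v1)
      1 0 0 0 (x2 / B2) (B1 * x2 / B2) 1 0 0 x2^-1) => //; rewrite ?A11;
    reach_tac.
subst x2.
have [v20|v20] := eqVneq v2 0; last first.
  have m0 : m = 0 by apply: (mulIf v20); rewrite mul0r; lra.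
  rewrite m0 in EA EB.
  have [A10 A20] : A1 = 0 /\ A2 = 0 by case: rect => //= -[]; lra.
  have [k k0 nk] := normalized_scale c12 (B1 - v1 / v2 * B2) (B2 / v2).
  exists 6%N; apply: (@reaches_item _ _ _ _
    (Item6 g1 (k * (B1 - v1 / v2 * B2)) (k * (B2 / v2)))
    1 0 0 0 k 0 1 (- v1 / v2) 0 v2^-1) => //; rewrite ?A10 ?A20;
    reach_tac.
subst v2; have [A20 B20] := pure_W_second G cl l0.
exists 12%N; apply: (@reaches_item _ _ _ _ (Item12 g1 v1 A1)
    1 0 0 0 1 0 1 (- B1 / B2) 0 B2^-1) => //; rewrite ?A20;
    reach_tac.
Qed.

Lemma classified_G (p1 x1 v1 A1 B1 p2 x2 v2 A2 B2 : R) :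
  classified (Coords 0 1 p1 x1 v1 A1 B1) (Coords 0 0 p2 x2 v2 A2 B2).
Proof.
move=> G; have [ind [l [m cl]] rect] := G.
have := cl; rewrite /coords_bracket /lin /= => -[Ed Eg Ep Ex Ev EA EB].
have l0 : l = 0 by lra.
rewrite l0 in Ep Ex Ev EA EB.
(* The bracket of G and Pt is a multiple of Px, but closure with l = 0 and m = 0 leaves no Px. *)
have p20 : p2 = 0.
  apply/eqP/negP => /negP p20.
  have m0 : m = 0 by apply: (mulIf p20); rewrite mul0r; lra.
  by move/eqP: p20; apply; rewrite m0 in Ex; lra.
subst p2.
have [x20|x20] := eqVneq x2 0; last first.
  have m0 : m = 0 by apply: (mulIf x20); rewrite mul0r; lra.
  rewrite m0 in Ev EA EB.
  have [A10 A20] : A1 = 0 /\ A2 = 0 by case: rect => //= -[]; lra.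
  exists 7%N; apply: reaches_eqv (reaches7 c12 c34 c7 (v1 - x1 / x2 * v2)
    (B1 - x1 / x2 * B2) (B2 / x2) p1 (v2 / x2)).
  rewrite [X in eqv _ _ X](_ : _ = lin 1 (Coords 0 1 p1 x1 v1 A1 B1)
    (- x1 / x2) (Coords 0 0 0 x2 v2 A2 B2)); last by rewrite A10 A20; coords_field.
  rewrite [X in eqv _ _ _ X](_ : _ = lin 0 (Coords 0 1 p1 x1 v1 A1 B1)
    (x2^-1) (Coords 0 0 0 x2 v2 A2 B2)); last by rewrite A20; coords_field.
  by apply: eqv_lin; rewrite mulr0 subr0 mul1r invr_neq0.
subst x2; have [t t0 bt] := bit_scale p1.
have [v20|v20] := eqVneq v2 0; last first.
  have m0 : m = 0 by apply: (mulIf v20); rewrite mul0r; lra.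
  rewrite m0 in EA EB.
  have [A10 A20] : A1 = 0 /\ A2 = 0 by case: rect => //= -[]; lra.
  have [k k0 nk] := normalized_scale c12 (B1 - v1 / v2 * B2) (B2 / v2).
  exists 8%N; apply: (@reaches_item _ _ _ _
    (Item8 (k * (B1 - v1 / v2 * B2)) (k * (B2 / v2)) (t * p1))
    t (t * x1) 0 0 k 0 1 (- v1 / v2) 0 v2^-1) => //; rewrite ?A10 ?A20;
    reach_tac.
subst v2; have [A20 B20] := pure_W_second G cl l0.
exists 13%N; apply: (@reaches_item _ _ _ _ (Item13 v1 A1 (t * p1))
    t (t * x1) 0 0 1 0 1 (- B1 / B2) 0 B2^-1) => //; rewrite ?A20;
    reach_tac.
Qed.

Lemma classified_Pt (x1 v1 A1 B1 x2 v2 A2 B2 : R) :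
  classified (Coords 0 0 1 x1 v1 A1 B1) (Coords 0 0 0 x2 v2 A2 B2).
Proof.
move=> G; have [ind [l [m cl]] rect] := G.
have := cl; rewrite /coords_bracket /lin /= => -[Ed Eg Ep Ex Ev EA EB].
have l0 : l = 0 by lra.
rewrite l0 in Ex Ev EA EB.
have [x20|x20] := eqVneq x2 0; last first.
  have m0 : m = 0 by apply: (mulIf x20); rewrite mul0r; lra.
  rewrite m0 in Ev EA EB.
  have [A10 A20] : A1 = 0 /\ A2 = 0 by case: rect => //= -[]; lra.
  exists 9%N; apply: reaches_eqv (reaches9 c12 c34 c7
    (B1 - x1 / x2 * B2) (B2 / x2) (v1 - x1 / x2 * v2) (v2 / x2)).
  rewrite [X in eqv _ _ X](_ : _ = lin 1 (Coords 0 0 1 x1 v1 A1 B1)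
    (- x1 / x2) (Coords 0 0 0 x2 v2 A2 B2)); last by rewrite A10 A20; coords_field.
  rewrite [X in eqv _ _ _ X](_ : _ = lin 0 (Coords 0 0 1 x1 v1 A1 B1)
    (x2^-1) (Coords 0 0 0 x2 v2 A2 B2)); last by rewrite A20; coords_field.
  by apply: eqv_lin; rewrite mulr0 subr0 mul1r invr_neq0.
subst x2.
have [v20|v20] := eqVneq v2 0; last first.
  have m0 : m = 0 by apply: (mulIf v20); rewrite mul0r; lra.
  rewrite m0 in EA EB.
  have [A10 A20] : A1 = 0 /\ A2 = 0 by case: rect => //= -[]; lra.
  exists 10%N; apply: reaches_eqv (reaches10 c12 c34 c7 (B1 - v1 / v2 * B2) (B2 / v2)).
  exists 1, 0, 0, (- x1), 1, 0, 1, (- v1 / v2), 0, v2^-1; split.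
  - exact/eqP/oner_neq0.
  - exact/eqP/oner_neq0.
  - by rewrite mulr0 subr0 mul1r; apply/eqP; rewrite invr_neq0.
  - by rewrite A10 A20; coords_field.
  - by rewrite A20; coords_field.
subst v2; have [A20 B20] := pure_W_second G cl l0.
have [t t0 nt] := normalized_scale c12 v1 A1.
(* The row factor [t] scales [v1] and [A1] together, since [A1] is insensitive to scalings of w;
   [T1 = 1 / t] restores Pt. *)
exists 14%N; apply: (@reaches_item _ _ _ _ (Item14 (t * v1) (t * A1))
    t^-1 0 0 (- x1) 1 0 t (- t * B1 / B2) 0 B2^-1) => //; rewrite ?A20;
    reach_tac.
Qed.

Lemma classified_Px (v1 A1 B1 v2 A2 B2 : R) :
  classified (Coords 0 0 0 1 v1 A1 B1) (Coords 0 0 0 0 v2 A2 B2).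
Proof.
move=> G; have [ind [l [m cl]] rect] := G.
have := cl; rewrite /coords_bracket /lin /= => -[Ed Eg Ep Ex Ev EA EB].
have l0 : l = 0 by lra.
rewrite l0 in Ev EA EB.
have [v20|v20] := eqVneq v2 0; last first.
  have m0 : m = 0 by apply: (mulIf v20); rewrite mul0r; lra.
  rewrite m0 in EA EB.
  have [A10 A20] : A1 = 0 /\ A2 = 0 by case: rect => //= -[]; lra.
  exists 11%N; apply: reaches_eqv (reaches11 c12 c34 c7 (B1 - v1 / v2 * B2) (B2 / v2)).
  exists 1, 0, 0, 0, 1, 0, 1, (- v1 / v2), 0, v2^-1; split.
  - exact/eqP/oner_neq0.
  - exact/eqP/oner_neq0.
  - by rewrite mulr0 subr0 mul1r; apply/eqP; rewrite invr_neq0.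
  - by rewrite A10 A20; coords_field.
  - by rewrite A20; coords_field.
subst v2; have [A20 B20] := pure_W_second G cl l0.
have [t t0 nt] := normalized_scale c12 v1 A1.
exists 15%N; apply: (@reaches_item _ _ _ _ (Item15 (t * v1) (t * A1))
    t^-1 0 0 0 1 0 t (- t * B1 / B2) 0 B2^-1) => //; rewrite ?A20;
    reach_tac.
Qed.

Lemma classified_Pv (A1 B1 A2 B2 : R) :
  classified (Coords 0 0 0 0 1 A1 B1) (Coords 0 0 0 0 0 A2 B2).
Proof.
move=> G; have [ind [l [m cl]] rect] := G.
have := cl; rewrite /coords_bracket /lin /= => -[_ _ _ _ Ev _ _].
have l0 : l = 0 by lra.
have [A20 B20] := pure_W_second G cl l0.
exists 16%N; apply: (@reaches_item _ _ _ _ (Item16 A1)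
    1 0 0 0 1 0 1 (- B1 / B2) 0 B2^-1) => //; rewrite ?A20;
    reach_tac.
Qed.

Lemma classified_W (A1 B1 A2 B2 : R) :
  classified (Coords 0 0 0 0 0 A1 B1) (Coords 0 0 0 0 0 A2 B2).
Proof.
move=> [ind _ rect].
have D : A1 * B2 - A2 * B1 != 0.
  apply/eqP => D; case: rect => //= -[A10 A20].
  (* Two constant components are proportional, so these rows would be dependent. *)
  have [|B20 B10] := ind B2 (- B1).
    by rewrite A10 A20 /lin /coords0 /=; congr Coords; ring.
  have [|_ /eqP] := ind 0 1; last by rewrite oner_eq0.
  by rewrite A20 B20 /lin /coords0 /=; congr Coords; ring.
exists 17%N; apply: (@reaches_item _ _ _ _ Item17 1 0 0 0 1 0
   (B2 / (A1 * B2 - A2 * B1)) (- B1 / (A1 * B2 - A2 * B1))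
   (- A2 / (A1 * B2 - A2 * B1)) (A1 / (A1 * B2 - A2 * B1))) => //;
  rewrite ?oner_neq0//; try by coords_field.
rewrite (_ : _ - _ = (A1 * B2 - A2 * B1)^-1) ?invr_neq0//.
by field.
Qed.

Lemma classification r1 r2 : classified r1 r2.
Proof.
have [[d1 d2]|nd] := EM (rd r1 = 0 /\ rd r2 = 0); last first.
  apply: (classified_pivot (pr := @rd R)) nd _ => // a b c d.
  move: (lin a r1 b r2) (lin c r1 d r2) => {}r1 {}r2.
  case: r1 r2 => [? g1 p1 x1 v1 A1 B1] [? g2 p2 x2 v2 A2 B2] /= -> ->.
  (* Translations of t and x clear Pt and Px in the row that contains D. *)
  apply: (classified_eqv (@eqv_act 1 p1 (x1 - p1 * g1) 0 1 0 _ _ _ _));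
    try exact: oner_neq0.
  rewrite /act /= (_ : 1 * p1 - _ = 0); last by ring.
  by rewrite (_ : 1 * x1 + _ - _ - _ = 0); [exact: classified_D|ring].
have [[g1 g2]|ng] := EM (rg r1 = 0 /\ rg r2 = 0); last first.
  apply: (classified_pivot (pr := @rg R)) ng _ => // a b c d.
  rewrite /lin /= d1 d2 !mulr0 !addr0 => -> ->; exact: classified_G.
have [[p1 p2]|np] := EM (rp r1 = 0 /\ rp r2 = 0); last first.
  apply: (classified_pivot (pr := @rp R)) np _ => // a b c d.
  rewrite /lin /= d1 d2 g1 g2 !mulr0 !addr0 => -> ->; exact: classified_Pt.
have [[x1 x2]|nx] := EM (rx r1 = 0 /\ rx r2 = 0); last first.
  apply: (classified_pivot (pr := @rx R)) nx _ => // a b c d.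
  rewrite /lin /= d1 d2 g1 g2 p1 p2 !mulr0 !addr0 => -> ->; exact: classified_Px.
have [[v1 v2]|nv] := EM (rv r1 = 0 /\ rv r2 = 0); last first.
  apply: (classified_pivot (pr := @rv R)) nv _ => // a b c d.
  rewrite /lin /= d1 d2 g1 g2 p1 p2 x1 x2 !mulr0 !addr0 => -> ->; exact: classified_Pv.
case: r1 r2 d1 d2 g1 g2 p1 p2 x1 x2 v1 v2 => [? ? ? ? ? ? ?] [? ? ? ? ? ? ?] /=.
do 10 move=> ->; exact: classified_W.
Qed.

End Classification.

(** * Vector fields *)

Section VectorFieldCalculus.
Variable R : realType.
Implicit Types (I J : set R) (p q v : 'rV[R]_5) (f g W Om : R -> R) (r : coords R).

Lemma tcE (t x u y w : R) : tc (mkpt t x u y w) = t.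
Proof. by rewrite /tc mxE. Qed.

Lemma xcE (t x u y w : R) : xc (mkpt t x u y w) = x.
Proof. by rewrite /xc mxE. Qed.

Lemma ucE (t x u y w : R) : uc (mkpt t x u y w) = u.
Proof. by rewrite /uc mxE. Qed.

Lemma vcE (t x u y w : R) : vc (mkpt t x u y w) = y.
Proof. by rewrite /vc mxE. Qed.

Lemma wcE (t x u y w : R) : wc (mkpt t x u y w) = w.
Proof. by rewrite /wc mxE. Qed.

Definition ptE := (tcE, xcE, ucE, vcE, wcE).

Lemma mkpt_eta p : p = mkpt (tc p) (xc p) (uc p) (vc p) (wc p).
Proof.
apply/rowP => -[[|[|[|[|[|i]]]]] Hi] //; rewrite mxE /=; congr (p _ _); exact/val_inj.
Qed.

Lemma mkpt_inj (t x u y w t' x' u' y' w' : R) :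
  mkpt t x u y w = mkpt t' x' u' y' w' -> [/\ t = t', x = x', u = u', y = y' & w = w'].
Proof.
move=> H; split; move: H.
- by move=> /(congr1 (@tc R)); rewrite !ptE.
- by move=> /(congr1 (@xc R)); rewrite !ptE.
- by move=> /(congr1 (@uc R)); rewrite !ptE.
- by move=> /(congr1 (@vc R)); rewrite !ptE.
- by move=> /(congr1 (@wc R)); rewrite !ptE.
Qed.

Lemma mkptD (t x u y w t' x' u' y' w' : R) :
  mkpt t x u y w + mkpt t' x' u' y' w' =
  mkpt (t + t') (x + x') (u + u') (y + y') (w + w').
Proof. by apply/rowP => -[[|[|[|[|[|i]]]]] Hi] //; rewrite !mxE. Qed.

Lemma mkptZ (k t x u y w : R) :
  k *: mkpt t x u y w = mkpt (k * t) (k * x) (k * u) (k * y) (k * w).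
Proof. by apply/rowP => -[[|[|[|[|[|i]]]]] Hi] //; rewrite !mxE. Qed.

Lemma mkpt0 : mkpt 0 0 0 0 0 = 0 :> 'rV[R]_5.
Proof. by apply/rowP => -[[|[|[|[|[|i]]]]] Hi] //; rewrite !mxE. Qed.

Lemma is_derive_coord (i : 'I_5) p v :
  is_derive p v (fun q : 'rV[R]_5 => q ord0 i) (v ord0 i).
Proof.
have d : derivable (id : 'rV[R]_5 -> 'rV[R]_5) p v by exact: derivable_id.
apply: DeriveDef; first exact: ((derivable_mxP _ _ _).1 d).
by have := congr1 (fun m : 'rV[R]_5 => m ord0 i) (derive_mx d); rewrite derive_id mxE => ->.
Qed.

Lemma is_derive_mkpt (f0 f1 f2 f3 f4 : 'rV[R]_5 -> R) (d0 d1 d2 d3 d4 : R) p v :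
  is_derive p v f0 d0 -> is_derive p v f1 d1 -> is_derive p v f2 d2 ->
  is_derive p v f3 d3 -> is_derive p v f4 d4 ->
  is_derive p v (fun q => mkpt (f0 q) (f1 q) (f2 q) (f3 q) (f4 q)) (mkpt d0 d1 d2 d3 d4).
Proof.
move=> H0 H1 H2 H3 H4.
have H i j : is_derive p v (fun q => mkpt (f0 q) (f1 q) (f2 q) (f3 q) (f4 q) i j)
    (mkpt d0 d1 d2 d3 d4 i j).
  case: j => -[|[|[|[|[|j]]]]] Hj //; rewrite !mxE /=;
    by under [X in is_derive _ _ X _]eq_fun do rewrite mxE /=.
have d : derivable (fun q => mkpt (f0 q) (f1 q) (f2 q) (f3 q) (f4 q)) p v.
  by apply/derivable_mxP => i j; case: (H i j).
apply: DeriveDef => //; rewrite derive_mx//; apply/matrixP => i j; rewrite mxE.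
by case: (H i j).
Qed.

(** The chain rule needs full differentiability of the inner and outer maps; for [f], a function of
    one variable, this is derivability. *)
Lemma is_derive_wc f p v : derivable f (wc p) 1 ->
  is_derive p v (fun q => f (wc q)) (derive1 f (wc p) * wc v).
Proof.
move=> df; have dw : differentiable (@wc R) p by exact: differentiable_coord.
have dfd : differentiable f (wc p) by exact/derivable1_diffP.
have dc : differentiable (f \o @wc R) p by exact: differentiable_comp.
apply: DeriveDef; first exact: diff_derivable.
rewrite deriveE// diff_comp//= diff1E// /GRing.scale /= mulrC; congr (_ * _).
by rewrite -deriveE//; case: (is_derive_coord (@Ordinal 5 4 isT) p v).
Qed.

Definition vf (d g p x v : R) (Om : R -> R) : vfield R :=
  d *: @vD R + g *: @vG R + p *: @vPt R + x *: @vPx R + v *: @vPv R + vW Om.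

Lemma vfE (d g p x v : R) Om q : vf d g p x v Om q =
  mkpt (d * tc q + p) (d * xc q + g * tc q + x) g v (Om (wc q)).
Proof.
rewrite /vf !fctE /vD /vG /vPt /vPx /vPv /vW !mkptZ !mkptD.
by congr mkpt; ring.
Qed.

Lemma derive_vf (d g p x v : R) Om q w : derivable Om (wc q) 1 ->
  'D_w (vf d g p x v Om) q =
  mkpt (d * tc w) (d * xc w + g * tc w) 0 0 (derive1 Om (wc q) * wc w).
Proof.
move=> dOm; rewrite (_ : vf _ _ _ _ _ _ = fun q =>
  mkpt (d * tc q + p) (d * xc q + g * tc q + x) g v (Om (wc q))); last first.
  by apply/funext => ?; rewrite vfE.
have dt := is_derive_coord (@Ordinal 5 0 isT) q w.
have dx := is_derive_coord (@Ordinal 5 1 isT) q w.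
apply: (@derive_val _ _ _ _ _ _ _ (is_derive_mkpt _ _ _ _ (is_derive_wc w dOm))).
- by apply: is_derive_eq; rewrite addr0.
- by apply: is_derive_eq; rewrite addr0.
Qed.

Lemma cyl_open I : open I -> open (cyl I).
Proof.
move=> oI; apply: (@open_comp _ _ (@wc R)) => // p _.
exact: (@coord_continuous _ 1 5 ord0 (@Ordinal 5 4 isT)).
Qed.

Lemma bracket_vf I (X Y : vfield R) (d1 g1 p1 x1 v1 d2 g2 p2 x2 v2 : R) f g :
  open I -> smooth_on I f -> smooth_on I g ->
  eq_on I X (vf d1 g1 p1 x1 v1 f) -> eq_on I Y (vf d2 g2 p2 x2 v2 g) ->
  eq_on I (bracket X Y)
    (vf 0 0 (d2 * p1 - d1 * p2) (d2 * x1 - d1 * x2 + (g2 * p1 - g1 * p2)) 0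
      (fun w => f w * derive1 g w - g w * derive1 f w)).
Proof.
move=> oI sf sg XE YE q Iq; rewrite /bracket.
(* The fields are known on the cylinder only, but it is open, so their derivatives agree there. *)
have D (Z Z' : vfield R) v : eq_on I Z Z' -> 'D_v Z q = 'D_v Z' q.
  by move=> ZE; apply: near_eq_derive; exact: near_open (cyl_open oI) Iq ZE.
rewrite (D _ _ _ XE) (D _ _ _ YE) (XE _ Iq) (YE _ Iq).
rewrite !derive_vf; [|exact: (sf 0%N)|exact: (sg 0%N)].
rewrite !vfE !ptE -[X in _ - X]scale1r -scaleNr mkptZ mkptD.
by congr mkpt; ring.
Qed.

Definition vfc r : vfield R :=
  vf (rd r) (rg r) (rp r) (rx r) (rv r) (fun w => rA r * w + rB r).

Lemma vfc_lin (a b : R) r s : vfc (lin a r b s) = a *: vfc r + b *: vfc s.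
Proof.
apply/funext => q; rewrite /vfc /lin !fctE !vfE /= !mkptZ mkptD; congr mkpt; ring.
Qed.

Lemma smooth_id_affine I (a b : R) : open I -> smooth_on I (fun w => a * w + b).
Proof. by move=> oI; apply: smooth_affine => //; exact: smooth_id. Qed.

Lemma derive1_affine (a b w : R) : derive1 (fun w => a * w + b) w = a.
Proof.
apply: derive1_val; apply: is_derive_eq.
by rewrite addr0 /GRing.scale /= mulr1.
Qed.

Lemma bracket_vfc I (X Y : vfield R) r s : open I ->
  eq_on I X (vfc r) -> eq_on I Y (vfc s) ->
  eq_on I (bracket X Y) (vfc (coords_bracket r s)).
Proof.
move=> oI XE YE q Iq.
rewrite (bracket_vf oI (@smooth_id_affine I (rA r) (rB r) oI)
  (@smooth_id_affine I (rA s) (rB s) oI) XE YE)//.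
rewrite /vfc !vfE /= !derive1_affine; congr mkpt; ring.
Qed.

(** At a single value of w, the points with (t, x) = (0, 0) and (1, 0) already determine the five
    constants. *)
Lemma vf_eq_on I (d1 g1 p1 x1 v1 d2 g2 p2 x2 v2 : R) f g : I !=set0 ->
  eq_on I (vf d1 g1 p1 x1 v1 f) (vf d2 g2 p2 x2 v2 g) ->
  [/\ d1 = d2, g1 = g2, p1 = p2, x1 = x2 & v1 = v2] /\ (forall w, I w -> f w = g w).
Proof.
move=> [w0 Iw0] E.
have F t x w : I w -> [/\ d1 * t + p1 = d2 * t + p2,
    d1 * x + g1 * t + x1 = d2 * x + g2 * t + x2, g1 = g2, v1 = v2 & f w = g w].
  move=> Iw; have /E : cyl I (mkpt t x 0 0 w) by rewrite /cyl /= wcE.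
  by rewrite !vfE !ptE => /mkpt_inj.
have [e1 e2 e3 e4 _] := F 0 0 _ Iw0; have [e5 _ _ _ _] := F 1 0 _ Iw0.
by split; [split; lra|move=> w /(F 0 0)[]].
Qed.

Lemma affine_eq0 I W (a b : R) : open_interval I -> smooth_on I W ->
  (forall w, I w -> derive1 W w <> 0) -> (forall w, I w -> a * W w + b = 0) ->
  a = 0 /\ b = 0.
Proof.
move=> [oI _ [w Iw]] sW W0 aWb.
have a0 : a = 0.
  have dW := derive1_is sW Iw.
  have d1 : is_derive w 1 (fun w => a * W w + b) (a * derive1 W w).
    by apply: is_derive_eq; rewrite addr0.
  have d2 : is_derive w 1 (fun w => a * W w + b) 0.
    apply: (@near_eq_is_derive _ _ _ (fun=> 0)).
    by apply: near_open oI Iw _ => y Iy; rewrite aWb.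
  move: (derive1_val d1); rewrite (derive1_val d2) => /esym/eqP.
  by rewrite mulf_eq0 => /orP[/eqP//|/eqP/W0].
by move: (aWb _ Iw); rewrite a0 mul0r add0r.
Qed.

Lemma vfc_eq0 I r : open_interval I -> eq_on I (vfc r) 0 -> r = coords0 R.
Proof.
move=> oI E; have [opI _ ne] := oI.
have E' : eq_on I (vfc r) (vf 0 0 0 0 0 (fun=> 0)).
  move=> q Iq; rewrite E// vfE -[LHS]/(0 : 'rV[R]_5) -mkpt0.
  by congr mkpt; ring.
have [[d g p x v] AB] := vf_eq_on ne E'.
have [|A B] := affine_eq0 oI (smooth_id opI) _ AB.
  by move=> w _; rewrite derive1_id; apply/eqP/oner_neq0.
by case: r d g p x v A B {E E' AB} => /= ? ? ? ? ? ? ? -> -> -> -> -> -> ->.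
Qed.

Lemma derive_transf (T1 T0 X0 U0 V0 : R) W p v : derivable W (wc p) 1 ->
  'D_v (transf T1 T0 X0 U0 V0 W) p =
  mkpt (T1 * tc v) (T1 * xc v + T1 * U0 * tc v) (uc v) (vc v)
    (derive1 W (wc p) * wc v).
Proof.
move=> dW.
have dt := is_derive_coord (@Ordinal 5 0 isT) p v.
have dx := is_derive_coord (@Ordinal 5 1 isT) p v.
have du := is_derive_coord (@Ordinal 5 2 isT) p v.
have dv := is_derive_coord (@Ordinal 5 3 isT) p v.
apply: (@derive_val _ _ _ _ _ _ _ (is_derive_mkpt _ _ _ _ (is_derive_wc v dW))).
- by apply: is_derive_eq; rewrite addr0.
- by apply: is_derive_eq; rewrite addr0.
- by apply: is_derive_eq; rewrite addr0.
- by apply: is_derive_eq; rewrite addr0.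
Qed.

(** The image field is taken at one point, with its w-component encoded as a constant function; this
    avoids the inverse of [W]. *)
Lemma derive_transf_vf (T1 T0 X0 U0 V0 : R) W p (d g pt px pv : R) Om :
  derivable W (wc p) 1 ->
  'D_(vf d g pt px pv Om p) (transf T1 T0 X0 U0 V0 W) p =
  vf d g (T1 * pt - T0 * d) (T1 * px + T1 * U0 * pt - X0 * d - T0 * g) pv
    (fun=> derive1 W (wc p) * Om (wc p)) (transf T1 T0 X0 U0 V0 W p).
Proof.
by move=> dW; rewrite derive_transf// !vfE /transf !ptE; congr mkpt; ring.
Qed.

End VectorFieldCalculus.

(** * From coordinate rows back to subalgebras, and exhaustiveness of the list *)

Section Equivalence.
Variable R : realType.
Implicit Types (I J : set R) (p q v : 'rV[R]_5) (f g W Om : R -> R) (r : coords R)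
  (X Y : vfield R) (S : set (vfield R)).

Lemma gens_vfc (s : item R) :
  gens s = (vfc (item_coords s).1, vfc (item_coords s).2).
Proof.
rewrite [LHS]surjective_pairing.
by case: s => *; rewrite /vfc /=; congr pair; apply/funext => q; rewrite vfE /=;
  rewrite ?fctE /vD /vG /vPt /vPx /vPv /vW ?mkptZ ?mkptD; congr mkpt; ring.
Qed.

Lemma item_spanE (s : item R) I :
  item_span s I = span2 I (vfc (item_coords s).1) (vfc (item_coords s).2).
Proof. by rewrite /item_span gens_vfc. Qed.

Lemma span2_gens I X Y : span2 I X Y X /\ span2 I X Y Y.
Proof.
split; [exists 1, 0|exists 0, 1] => q _; by rewrite scale1r scale0r ?addr0 ?add0r.
Qed.

Lemma span2_vfc I r1 r2 X : span2 I (vfc r1) (vfc r2) X ->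
  exists a b : R, eq_on I X (vfc (lin a r1 b r2)).
Proof. by move=> [a [b XE]]; exists a, b; rewrite vfc_lin. Qed.

Lemma subalgebra2_span2 I r1 r2 : open_interval I -> indep_coords r1 r2 ->
  (exists l m, coords_bracket r1 r2 = lin l r1 m r2) ->
  subalgebra2 I (span2 I (vfc r1) (vfc r2)).
Proof.
move=> oI ind [l [m cl]]; have [opI _ _] := oI; split.
- exists (vfc r1), (vfc r2); split=> // a b; rewrite -vfc_lin => E.
  exact: ind (vfc_eq0 oI E).
- move=> X /span2_vfc[a [b XE]].
  exists (rd (lin a r1 b r2)), (rg (lin a r1 b r2)), (rp (lin a r1 b r2)).
  exists (rx (lin a r1 b r2)), (rv (lin a r1 b r2)).
  exists (fun w => rA (lin a r1 b r2) * w + rB (lin a r1 b r2)).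
  by split; [exact: smooth_id_affine opI|exact: XE].
- move=> X Y /span2_vfc[a [b XE]] /span2_vfc[c [d YE]].
  exists ((a * d - b * c) * l), ((a * d - b * c) * m); rewrite -vfc_lin.
  rewrite (_ : lin _ _ _ _ = coords_bracket (lin a r1 b r2) (lin c r1 d r2)).
    exact: bracket_vfc.
  transitivity (lin (a * d - b * c) (coords_bracket r1 r2) 0 r1).
    by rewrite cl /lin /=; congr Coords; ring.
  by rewrite /lin /coords_bracket /=; congr Coords; ring.
Qed.

Lemma item_indep (s : item R) : indep_coords (item_coords s).1 (item_coords s).2.
Proof.
by case: s => * a b; rewrite /lin /coords0 /= => -[*]; split; lra.
Qed.

Lemma item_closed (s : item R) : exists l m : R,
  coords_bracket (item_coords s).1 (item_coords s).2 =
  lin l (item_coords s).1 m (item_coords s).2.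
Proof.
(* The eigenvalue of the second generator: -1 from D on Pt or Px, and from w on 1 in family 17;
   [- c] from c W(w) on W(1). *)
exists 0, (match s with
  | Item2 _ _ | Item3 _ | Item4 _ _ _ | Item5 _ _ | Item17 => -1
  | Item12 _ _ c | Item13 _ c _ | Item14 _ c | Item15 _ c | Item16 c => - c
  | _ => 0 end).
by case: s => * /=; rewrite /lin /coords_bracket /=; congr Coords; ring.
Qed.

Lemma item_subalgebra (s : item R) I : open_interval I -> subalgebra2 I (item_span s I).
Proof.
move=> oI; rewrite item_spanE; apply: subalgebra2_span2 => //.
  exact: item_indep.
exact: item_closed.
Qed.

Lemma transf_surj (T1 T0 X0 U0 V0 : R) W w q : T1 <> 0 -> W w = wc q ->
  exists2 p, wc p = w & q = transf T1 T0 X0 U0 V0 W p.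
Proof.
move=> T10 wq.
exists (mkpt ((tc q - T0) / T1) ((xc q - T1 * U0 * ((tc q - T0) / T1) - X0) / T1)
  (uc q - U0) (vc q - V0) w); first by rewrite wcE.
rewrite /transf !ptE [LHS]mkpt_eta wq.
by congr mkpt; field; exact/eqP.
Qed.

(** The rows describe the fields in the coordinate [W]; the transformation realising the equivalence
    uses the composite [k * W + l]. *)
Lemma eqv_equivalent I (S : set (vfield R)) X Y (d1 g1 p1 x1 v1 d2 g2 p2 x2 v2 : R)
    f g W A1 B1 A2 B2 r1 r2 :
  open_interval I -> S = span2 I X Y ->
  eq_on I X (vf d1 g1 p1 x1 v1 f) -> eq_on I Y (vf d2 g2 p2 x2 v2 g) ->
  smooth_on I W -> (forall w, I w -> derive1 W w <> 0) ->
  (forall w, I w -> derive1 W w * f w = A1 * W w + B1) ->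
  (forall w, I w -> derive1 W w * g w = A2 * W w + B2) ->
  eqv (Coords d1 g1 p1 x1 v1 A1 B1) (Coords d2 g2 p2 x2 v2 A2 B2) r1 r2 ->
  exists2 J, open_interval J & equivalent I J S (span2 J (vfc r1) (vfc r2)).
Proof.
move=> oI -> XE YE sW W0 Wf Wg.
move=> [T1 [T0 [X0 [U0 [k [l [a [b [c [d [T10 k0 D0 r1E r2E]]]]]]]]]]].
have [opI _ _] := oI; pose V w := k * W w + l.
have sV : smooth_on I V by exact: smooth_affine.
have dV w : I w -> derive1 V w = k * derive1 W w.
  move=> Iw; have dW := derive1_is sW Iw.
  by apply: derive1_val; apply: is_derive_eq; rewrite addr0.
have V0 w : I w -> derive1 V w <> 0.
  move=> Iw; rewrite dV// => /eqP; rewrite mulf_eq0 => /orP[/eqP//|/eqP].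
  exact: W0.
exists (V @` I); first exact: smooth_image_open_interval.
(* Translations of v fix every field of the algebra, so [V0] may be taken 0. *)
exists T1, T0, X0, U0, 0, V; split=> //.
set Phi := transf _ _ _ _ _ _.
set a1 := act T1 T0 X0 U0 k l _ in r1E r2E; set a2 := act T1 T0 X0 U0 k l _ in r1E r2E.
have push (e h : R) p : cyl I p ->
    'D_((e *: X + h *: Y) p) Phi p = vfc (lin e a1 h a2) (Phi p).
  move=> Ip; have dp : derivable V (wc p) 1 by exact: (sV 0%N).
  rewrite !fctE XE// YE// derive_transf// /vfc !vfE !mkptZ mkptD !ptE dV//.
  have F := Wf _ Ip; have G := Wg _ Ip.
  congr mkpt; rewrite /lin /=; try ring.
  transitivity (k * (e * (derive1 W (wc p) * f (wc p)) + h * (derive1 W (wc p) * g (wc p)))).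
    by ring.
  by rewrite F G /V; ring.
have surj q : cyl (V @` I) q -> exists2 p, cyl I p & q = Phi p.
  move=> [w Iw /(transf_surj T0 X0 U0 0 T10)[p pw ->]].
  by exists p => //; rewrite /cyl /= pw.
have Phi_cyl p : cyl I p -> cyl (V @` I) (Phi p).
  by move=> Ip; rewrite /cyl /= /Phi /transf wcE; exists (wc p).
have comb e h : lin e r1 h r2 = lin (e * a + h * c) a1 (e * b + h * d) a2.
  by rewrite -r1E -r2E /lin; congr Coords => /=; ring.
apply/seteqP; split=> Z.
  move=> [e [h ZE]].
  exists ((e * a + h * c) *: X + (e * b + h * d) *: Y); first by do 2 eexists.
  by move=> p Ip; rewrite (push _ _ _ Ip) (ZE _ (Phi_cyl _ Ip)) -vfc_lin comb.
move=> [X' [e [h XE']] ZE].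
pose D := a * d - b * c.
have eE : (e * d - h * c) / D * a + (h * a - e * b) / D * c = e.
  by rewrite /D; field; exact/eqP.
have hE : (e * d - h * c) / D * b + (h * a - e * b) / D * d = h.
  by rewrite /D; field; exact/eqP.
exists ((e * d - h * c) / D), ((h * a - e * b) / D) => q /surj[p Ip ->].
by rewrite (ZE _ Ip) (XE' _ Ip) (push _ _ _ Ip) -vfc_lin comb eE hE.
Qed.

(** Differentiating the rectifying relation exposes W''. Used for two components it lets W'' be
    eliminated; used at one point it gives the derivative coordinate of the jet. *)
Lemma derive_rectified I W h (A B w : R) : open I -> smooth_on I W -> smooth_on I h ->
  (forall w, I w -> derive1 W w * h w = A * W w + B) -> I w ->
  derive1 (derive1 W) w * h w + derive1 W w * derive1 h w = A * derive1 W w.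
Proof.
move=> oI sW sh H Iw; have dW := derive1_is sW Iw; have dh := derive1_is sh Iw.
have d2W := derive1_is (smooth_onS sW).2 Iw.
have e3 : is_derive w 1 (fun w => derive1 W w * h w)
    (derive1 (derive1 W) w * h w + derive1 W w * derive1 h w).
  by apply: is_derive_eq; rewrite /GRing.scale /=; ring.
have e1 : is_derive w 1 (fun w => A * W w + B) (A * derive1 W w).
  by apply: is_derive_eq; rewrite addr0.
have e2 : is_derive w 1 (fun w => derive1 W w * h w) (A * derive1 W w).
  by apply: near_eq_is_derive e1; apply: near_open oI Iw _ => y Iy; rewrite H.
by rewrite -(derive1_val e2) (derive1_val e3).
Qed.

Lemma exhaustive c12 c34 c7 I S : open_interval I -> subalgebra2 I S -> regular2 I S ->
  exists s J, [/\ (listed c12 c34 c7 `&` irredundant c7) s, open_interval J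
    & equivalent I J S (item_span s J)].
Proof.
move=> oI [_ Sg Sbr] [X [Y [[ind SE] zX zY]]].
have [opI _ ne] := oI; have [w0 Iw0] := ne.
have [SX SY] : S X /\ S Y by rewrite SE; exact: span2_gens.
have [d1 [g1 [p1 [x1 [v1 [f [sf XE]]]]]]] := Sg _ SX.
have [d2 [g2 [p2 [x2 [v2 [g [sg YE]]]]]]] := Sg _ SY.
have := Sbr _ _ SX SY; rewrite {1}SE => -[l [m brE]].
have E : eq_on I (vf 0 0 (d2 * p1 - d1 * p2) (d2 * x1 - d1 * x2 + (g2 * p1 - g1 * p2)) 0
    (fun w => f w * derive1 g w - g w * derive1 f w))
    (vf (l * d1 + m * d2) (l * g1 + m * g2) (l * p1 + m * p2) (l * x1 + m * x2)
      (l * v1 + m * v2) (fun w => l * f w + m * g w)).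
  move=> q Iq; rewrite -(bracket_vf opI sf sg XE YE Iq) brE// !fctE XE// YE//.
  by rewrite -!/(vf _ _ _ _ _ _) !vfE !mkptZ mkptD; congr mkpt; ring.
have [[Ed Eg Ep Ex Ev] EO] := vf_eq_on ne E.
have zero_or Z (d g' p x v : R) Om : eq_on I Z (vf d g' p x v Om) ->
    zero_or_nonvanishing I Z ->
    (forall w, I w -> Om w = 0) \/ (forall w, I w -> Om w != 0).
  move=> ZE zZ; have ZO w : I w -> wc (Z (mkpt 0 0 0 0 w)) = Om w.
    by move=> Iw; rewrite ZE; [rewrite vfE !wcE|rewrite /cyl /= wcE].
  case: zZ => H; [left|right] => w Iw; rewrite -ZO//; last apply/eqP;
    by apply: H; rewrite /cyl /= wcE.
have [W [A1 [B1 [A2 [B2 [sW W0 Wf Wg AB]]]]]] := rectify oI sf sg (zero_or _ _ _ _ _ _ _ XE zX)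
  (zero_or _ _ _ _ _ _ _ YE zY) EO.
have G : good (Coords d1 g1 p1 x1 v1 A1 B1) (Coords d2 g2 p2 x2 v2 A2 B2).
  split=> //.
    move=> a b; rewrite /lin /coords0 /= => -[Hd Hg Hp Hx Hv HA HB].
    apply: ind => q Iq; rewrite !fctE XE// YE// -!/(vf _ _ _ _ _ _) !vfE !mkptZ mkptD.
    rewrite -[RHS]/(0 : 'rV[R]_5) -mkpt0; congr mkpt.
    - transitivity ((a * d1 + b * d2) * tc q + (a * p1 + b * p2)); first by ring.
      by rewrite Hd Hp; ring.
    - transitivity ((a * d1 + b * d2) * xc q + (a * g1 + b * g2) * tc q + (a * x1 + b * x2)).
        by ring.
      by rewrite Hd Hg Hx; ring.
    - by [].
    - by [].
    - apply: (mulfI (introN eqP (W0 _ Iq))); rewrite mulr0.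
      transitivity (a * (derive1 W (wc q) * f (wc q)) + b * (derive1 W (wc q) * g (wc q))).
        by ring.
      rewrite Wf// Wg//.
      transitivity ((a * A1 + b * A2) * W (wc q) + (a * B1 + b * B2)); first by ring.
      by rewrite HA HB; ring.
  exists l, m; rewrite /coords_bracket /lin /=.
  (* Eliminating W'' between the two differentiated relations. *)
  have wr w : I w -> f w * derive1 g w - g w * derive1 f w = A2 * f w - A1 * g w.
    move=> Iw; have F := derive_rectified opI sW sf Wf Iw.
    have H := derive_rectified opI sW sg Wg Iw.
    apply: (mulfI (introN eqP (W0 _ Iw))).
    transitivity (f w * (derive1 (derive1 W) w * g w + derive1 W w * derive1 g w) -
      g w * (derive1 (derive1 W) w * f w + derive1 W w * derive1 f w)); first by ring.
    by rewrite F H; ring.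
  (* Both expressions of the bracket, multiplied by W', are affine in [W], so their coefficients
     agree. *)
  have [HA HB] : l * A1 + m * A2 = 0 /\ l * B1 + m * B2 - (A2 * B1 - A1 * B2) = 0.
    apply: (affine_eq0 oI sW W0) => w Iw.
    have := wr _ Iw; rewrite EO// => H.
    transitivity (derive1 W w * (l * f w + m * g w) - derive1 W w * (A2 * f w - A1 * g w));
      last by rewrite H subrr.
    transitivity (l * (derive1 W w * f w) + m * (derive1 W w * g w) -
      (A2 * (derive1 W w * f w) - A1 * (derive1 W w * g w))); last by ring.
    by rewrite Wf// Wg//; ring.
  by congr Coords; lra.
have [n [s [Ls irs _ e]]] := classification c12 c34 c7 G.
have [J oJ eqJ] := eqv_equivalent oI SE XE YE sW W0 Wf Wg e.
by exists s, J; rewrite item_spanE.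
Qed.

End Equivalence.

(** * Inequivalence of the items *)

Section Inequivalence.
Variable R : realType.
Implicit Types (I J : set R) (W : R -> R) (r : coords R) (s : item R).

(* The last two coordinates are the derivative and the value at w of the
   w-component. *)
Definition jet (w : R) r : coords R :=
  Coords (rd r) (rg r) (rp r) (rx r) (rv r) (rA r) (rA r * w + rB r).

(* k and kap are W' and W'' / W' at the base point. *)
Definition jact (T1 T0 X0 U0 k kap : R) r : coords R :=
  Coords (rd r) (rg r) (T1 * rp r - T0 * rd r)
      (T1 * rx r + T1 * U0 * rp r - X0 * rd r - T0 * rg r) (rv r)
      (rA r + kap * rB r) (k * rB r).

Lemma pushforward_jet I (T1 T0 X0 U0 V0 : R) W r r' (w : R) : open I -> T1 <> 0 ->
  smooth_on I W -> (forall w, I w -> derive1 W w <> 0) -> I w ->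
  (forall p, cyl I p -> vfc r' (transf T1 T0 X0 U0 V0 W p) =
    'D_(vfc r p) (transf T1 T0 X0 U0 V0 W) p) ->
  jet (W w) r' = jact T1 T0 X0 U0 (derive1 W w) (derive1 (derive1 W) w / derive1 W w)
    (jet w r).
Proof.
move=> oI T10 sW W0 Iw push.
have E y : I y -> [/\ rd r' = rd r, rg r' = rg r, rp r' = T1 * rp r - T0 * rd r,
    rx r' = T1 * rx r + T1 * U0 * rp r - X0 * rd r - T0 * rg r & rv r' = rv r] /\
    rA r' * W y + rB r' = derive1 W y * (rA r * y + rB r).
  (* The image field is known over the point [W y], and this single fibre suffices for
     [vf_eq_on]. *)
  move=> Iy; have : eq_on [set W y] (vfc r') (vf (rd r) (rg r) (T1 * rp r - T0 * rd r)
      (T1 * rx r + T1 * U0 * rp r - X0 * rd r - T0 * rg r) (rv r)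
      (fun=> derive1 W y * (rA r * y + rB r))).
    move=> q /esym/(transf_surj T0 X0 U0 V0 T10)[p py ->].
    have Ip : cyl I p by rewrite /cyl /= py.
    rewrite push// derive_transf_vf; last exact: (sW 0%N).
    by rewrite !vfE py.
  by move=> /vf_eq_on[|e /(_ (W y) erefl)]; first by exists (W y).
have [[Ed Eg Ep Ex Ev] EB] := E w Iw.
rewrite /jet /jact /= Ed Eg Ep Ex Ev EB; congr Coords.
have := @derive_rectified _ I W (fun y => rA r * y + rB r) (rA r') (rB r') w oI sW.
rewrite derive1_affine => /(_ (@smooth_id_affine _ I _ _ oI)) H.
have /eqP W0w := W0 _ Iw; apply: (mulIf W0w).
by rewrite -H => [|y /E[_ ->]//|//]; field.
Qed.

(** What remains of an equivalence at one value [w] with image [w']: of W only W' and W'' / W' are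
    kept. *)
Definition jet_equivalent r1 r2 r1' r2' : Prop :=
  exists T1 T0 X0 U0 k kap a b c d w w' : R,
    [/\ T1 <> 0, k <> 0, a * d - b * c <> 0,
        jet w' r1' = jact T1 T0 X0 U0 k kap (lin a (jet w r1) b (jet w r2))
      & jet w' r2' = jact T1 T0 X0 U0 k kap (lin c (jet w r1) d (jet w r2))].

Lemma jet_lin (w a b : R) r1 r2 : jet w (lin a r1 b r2) = lin a (jet w r1) b (jet w r2).
Proof. by rewrite /jet /lin /=; congr Coords; ring. Qed.

Lemma equivalent_jet s s' I J : open_interval I ->
  equivalent I J (item_span s I) (item_span s' J) ->
  jet_equivalent (item_coords s).1 (item_coords s).2 (item_coords s').1 (item_coords s').2.
Proof.
move=> [oI _ [w Iw]] [T1 [T0 [X0 [U0 [V0 [W [T10 [sW W0 _] SE]]]]]]].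
have lift r' : item_span s' J (vfc r') -> exists a b,
    jet (W w) r' = jact T1 T0 X0 U0 (derive1 W w) (derive1 (derive1 W) w / derive1 W w)
      (lin a (jet w (item_coords s).1) b (jet w (item_coords s).2)).
  rewrite SE => -[X]; rewrite item_spanE => /span2_vfc[a [b XE]] push.
  exists a, b; rewrite -jet_lin;
  apply: (@pushforward_jet I _ _ _ _ V0 _ _ _ _ oI T10 sW W0 Iw) => p Ip.
  by rewrite (push _ Ip) (XE _ Ip).
have [S1 S2] : item_span s' J (vfc (item_coords s').1) /\
    item_span s' J (vfc (item_coords s').2) by rewrite item_spanE; exact: span2_gens.
have [a [b E1]] := lift _ S1; have [c [d E2]] := lift _ S2.
exists T1, T0, X0, U0, (derive1 W w), (derive1 (derive1 W) w / derive1 W w).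
exists a, b, c, d, w, (W w); split=> //; first exact: W0.
move=> D.
have ind (e h : R) : e * a + h * c = 0 -> e * b + h * d = 0 -> e = 0 /\ h = 0.
  move=> H1 H2; apply: (@item_indep R s').
  have : jet (W w) (lin e (item_coords s').1 h (item_coords s').2) = coords0 R.
    rewrite jet_lin E1 E2.
    transitivity (jact T1 T0 X0 U0 (derive1 W w) (derive1 (derive1 W) w / derive1 W w)
      (lin (e * a + h * c) (jet w (item_coords s).1)
        (e * b + h * d) (jet w (item_coords s).2))).
      by rewrite /lin /jact /=; congr Coords; ring.
    by rewrite H1 H2 /lin /jact /coords0 /=; congr Coords; ring.
  move: (lin _ _ _ _) => [? ? ? ? ? A B]; rewrite /jet /coords0 /=.
  by move=> -[-> -> -> -> -> ->]; rewrite mul0r add0r => ->.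
(* For a singular matrix the adjugate combinations of the independent rows of [s'] vanish, so all
   four entries are 0. *)
have [||c0 a0] := ind c (- a); first by ring.
  by transitivity (- (a * d - b * c)); [ring|rewrite D oppr0].
have [||d0 b0] := ind d (- b); [by rewrite -D; ring|by ring|].
have a00 : a = 0 by rewrite -[a]opprK a0 oppr0.
have b00 : b = 0 by rewrite -[b]opprK b0 oppr0.
have [||/eqP] := ind 1 0; last by rewrite oner_eq0.
  by rewrite a00 c0; ring.
by rewrite b00 d0; ring.
Qed.

End Inequivalence.

(** * Pivots of the items and injectivity of their parameters *)

Section Uniqueness.
Variable R : realType.
Implicit Types (r : coords R) (s : item R).

(* The pivot position of r; the zero row also gets 5. *)
Definition lead r : nat :=
  if rd r != 0 then 0%N else if rg r != 0 then 1%N else if rp r != 0 then 2%N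
  else if rx r != 0 then 3%N else if rv r != 0 then 4%N else 5%N.

Lemma lead_jact (T1 T0 X0 U0 k kap : R) r : T1 != 0 ->
  lead (jact T1 T0 X0 U0 k kap r) = lead r.
Proof.
move=> T10; rewrite /lead /=.
have [->|//] := eqVneq (rd r) 0; have [->|//] := eqVneq (rg r) 0.
rewrite !mulr0 !subr0 mulf_eq0 (negPf T10) /=.
have [->|//] := eqVneq (rp r) 0.
by rewrite !mulr0 addr0 mulf_eq0 (negPf T10).
Qed.

Lemma lead_lin (a b : R) r1 r2 : (lead r1 < lead r2)%N ->
  lead (lin a r1 b r2) = if a != 0 then lead r1 else if b != 0 then lead r2 else 5%N.
Proof.
case: r1 r2 => [d1 g1 p1 x1 v1 A1 B1] [d2 g2 p2 x2 v2 A2 B2]; rewrite /lead /=.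
have [->|a0] := eqVneq a 0; have [->|b0] := eqVneq b 0 => /=;
  rewrite ?mul0r ?add0r ?addr0 ?eqxx ?mulf_eq0 ?(negPf b0) ?(negPf a0) //=;
  case: (eqVneq d2 0) => [->|d20] /=; case: (eqVneq d1 0) => [->|d10] //=;
  rewrite ?mulr0 ?addr0 ?eqxx ?mulf_eq0 ?(negPf a0) ?(negPf d10) //=;
  case: (eqVneq g2 0) => [->|g20] /=; case: (eqVneq g1 0) => [->|g10] //=;
  rewrite ?mulr0 ?addr0 ?eqxx ?mulf_eq0 ?(negPf a0) ?(negPf g10) //=;
  case: (eqVneq p2 0) => [->|p20] /=; case: (eqVneq p1 0) => [->|p10] //=;
  rewrite ?mulr0 ?addr0 ?eqxx ?mulf_eq0 ?(negPf a0) ?(negPf p10) //=;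
  case: (eqVneq x2 0) => [->|x20] /=; case: (eqVneq x1 0) => [->|x10] //=;
  rewrite ?mulr0 ?addr0 ?eqxx ?mulf_eq0 ?(negPf a0) ?(negPf x10) //=;
  case: (eqVneq v2 0) => [->|v20] /=; case: (eqVneq v1 0) => [->|v10] //=;
  by rewrite ?mulr0 ?addr0 ?eqxx ?mulf_eq0 ?(negPf a0) ?(negPf v10).
Qed.

Lemma bit_inj (k x : R) : k != 0 -> bit x -> bit (k * x) -> k * x = x.
Proof.
move=> k0 [->|->]; rewrite ?mulr0// mulr1 => -[k0'|//].
by rewrite k0' eqxx in k0.
Qed.

Lemma normalized_inj c (k x y : R) : k != 0 -> normalized c x y ->
  normalized c (k * x) (k * y) -> k * x = x /\ k * y = y.
Proof.
have cancel (u v : R) : u = 1 \/ (u = 0 /\ bit v) -> k != 0 ->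
    k * u = 1 \/ (k * u = 0 /\ bit (k * v)) -> k * u = u /\ k * v = v.
  case=> [->|[-> bv]] k0; rewrite ?mulr1 ?mulr0.
    by case=> [->|[k0']]; [rewrite !mul1r|rewrite k0' eqxx in k0].
  by case=> [/esym/eqP|[_ bkv]]; [rewrite oner_eq0|rewrite bit_inj].
move=> k0; case: c => /=; first by move=> *; exact: cancel.
by move=> H H'; have [-> ->] := cancel _ _ H k0 H'.
Qed.

(** The last conclusion supplies the hypothesis [m = k] of [reduced_inj] in family 7. *)
Lemma normalized_hyperbolic_inj c (k l x y : R) : k * l = 1 -> normalized c x y ->
  normalized c (k * x) (l * y) -> [/\ k * x = x, l * y = y & y != 0 -> l = 1].
Proof.
have cancel (m n u v : R) : m * n = 1 -> u = 1 \/ (u = 0 /\ bit v) ->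
    m * u = 1 \/ (m * u = 0 /\ bit (n * v)) ->
    [/\ m * u = u, n * v = v & (u != 0 -> m = 1) /\ (v != 0 -> n = 1)].
  move=> mn.
  have [m0 n0] : m != 0 /\ n != 0.
    by split; apply/eqP => z; move: mn; rewrite z ?mul0r ?mulr0 => /esym/eqP; rewrite oner_eq0.
  case=> [->|[-> bv]]; rewrite ?mulr1 ?mulr0.
    case=> [m1|[m0']]; last by rewrite m0' eqxx in m0.
    by move: mn; rewrite m1 mul1r => ->; rewrite mul1r.
  case=> [/esym/eqP|[_ bnv]]; first by rewrite oner_eq0.
  rewrite eqxx; split=> //; first exact: bit_inj.
  split=> // v0; have := bit_inj n0 bv bnv; rewrite -[RHS]mul1r.
  exact: mulIf.
move=> kl; case: c => /= H H'; first by have [? ? []] := cancel _ _ _ _ kl H H'.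
rewrite mulrC in kl; have [? ? []] := cancel _ _ _ _ kl H H'.
by split=> // y0; auto.
Qed.

(** If [d2] and [d4] are both nonzero, the chosen coefficient vanishes before and after, so s = 0.
    Otherwise any coefficient that the shift can move is 0 before and after. The factor [h] is [k],
    except when [d2] alone is nonzero: then [d1] is 0 and [h] is [m]. *)
Lemma reduced_inj c (a d1 d2 d4 s t k m n : R) :
  t != 0 -> k != 0 -> m != 0 -> n != 0 -> (d4 != 0 -> m = k) ->
  reduced c a d1 d2 d4 ->
  reduced c (t * (a + s * d4)) (k * (d1 + s * d2)) (m * d2) (n * d4) ->
  t * (a + s * d4) = t * a /\
  exists2 h, h != 0 & k * (d1 + s * d2) = h * d1 /\ m * d2 = h * d2.
Proof.
move=> t0 k0 m0 n0 mk.
have cancel (y z : R) : y != 0 -> y * z = 0 -> z = 0.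
  by move=> y0 /eqP; rewrite mulf_eq0 (negPf y0) => /eqP.
have [d40|d40] := eqVneq d4 0; have [d20|d20] := eqVneq d2 0.
- by move=> _ _; rewrite d40 d20 !mulr0 !addr0; split=> //; exists k; rewrite // !mulr0.
- rewrite d40 !mulr0 addr0; have nd2 : m * d2 <> 0 by apply/eqP/mulf_neq0.
  move/eqP: d20 => d20.
  case: c => /= -[H1 H2] [H3 H4]; split=> //; exists m => //.
    by rewrite (H4 erefl nd2) (H2 erefl d20) mulr0.
  by rewrite (H3 nd2) (H1 d20) mulr0.
- rewrite d20 !mulr0 addr0; have nd4 : n * d4 <> 0 by apply/eqP/mulf_neq0.
  move/eqP: d40 => d40.
  move=> H1 H2; split; last by exists k => //; rewrite !mulr0.
  have [-> ->] : a = 0 /\ t * (a + s * d4) = 0.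
    by case: c H1 H2 => /= -[H1 H2] [H3 H4]; auto.
  by rewrite mulr0.
- have nd4 : n * d4 <> 0 by apply/eqP/mulf_neq0.
  have nd2 : m * d2 <> 0 by apply/eqP/mulf_neq0.
  move/eqP: (d40) => e40; move/eqP: (d20) => e20.
  suff s0 : reduced c a d1 d2 d4 ->
      reduced c (t * (a + s * d4)) (k * (d1 + s * d2)) (m * d2) (n * d4) -> s = 0.
    by move=> H1 H2; rewrite (s0 H1 H2) (mk d40) !mul0r !addr0; split=> //; exists k.
  case: c => /= -[H1 _] [H2 _].
    move: (cancel _ _ t0 (H2 nd4)); rewrite (H1 e40) add0r mulrC; exact: cancel.
  move: (cancel _ _ k0 (H2 nd2)); rewrite (H1 e20) add0r mulrC; exact: cancel.
Qed.

Definition item_leads s : nat * nat :=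
  match s with
  | Item1 _ _ _ _ => (0, 1) | Item2 _ _ => (0, 2) | Item3 _ => (0, 2)
  | Item4 _ _ _ => (0, 3) | Item5 _ _ => (0, 3) | Item6 _ _ _ => (0, 4)
  | Item7 _ _ _ _ _ => (1, 3) | Item8 _ _ _ => (1, 4) | Item9 _ _ _ _ => (2, 3)
  | Item10 _ _ => (2, 4) | Item11 _ _ => (3, 4) | Item12 _ _ _ => (0, 5)
  | Item13 _ _ _ => (1, 5) | Item14 _ _ => (2, 5) | Item15 _ _ => (3, 5)
  | Item16 _ => (4, 5) | Item17 => (5, 5)
  end%N.

Lemma item_leadsE s w :
  lead (jet w (item_coords s).1) = (item_leads s).1 /\
  lead (jet w (item_coords s).2) = (item_leads s).2.
Proof. by case: s => *; rewrite /lead /= ?eqxx ?oner_eq0 /=. Qed.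

Lemma item_leads_lt s : s <> Item17 -> ((item_leads s).1 < (item_leads s).2 <= 5)%N.
Proof. by case: s. Qed.

(** The pivots are distinct, so rows with increasing pivots can only be reached by a triangular
    matrix. Item 17 is excluded because its two pivots coincide. *)
Lemma jet_triangular s s' :
  jet_equivalent (item_coords s).1 (item_coords s).2 (item_coords s').1 (item_coords s').2 ->
  s <> Item17 -> item_leads s = item_leads s' /\
  exists T1 T0 X0 U0 k kap a b d w w' : R,
    [/\ T1 != 0, k != 0, d != 0,
        jet w' (item_coords s').1 =
          jact T1 T0 X0 U0 k kap (lin a (jet w (item_coords s).1) b (jet w (item_coords s).2))
      & jet w' (item_coords s').2 =
          jact T1 T0 X0 U0 k kap (lin 0 (jet w (item_coords s).1) d (jet w (item_coords s).2))].
Proof.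
move=> [T1 [T0 [X0 [U0 [k [kap [a [b [c [d [w [w' [/eqP T10 /eqP k0 D E1 E2]]]]]]]]]]]]].
move=> /item_leads_lt/andP[lt12 le5].
have [L1 L2] := item_leadsE s w; have [L1' L2'] := item_leadsE s' w'.
have lt5 := leq_trans lt12 le5; have lt12' := lt12; rewrite -L1 -L2 in lt12'.
rewrite E1 lead_jact// lead_lin// L1 L2 in L1'.
rewrite E2 lead_jact// lead_lin// L1 L2 in L2'.
have ne17 : s' <> Item17.
  move=> s17; rewrite s17 /= in L1' L2'; apply: D.
  have [a0|a0] := eqVneq a 0; last first.
    by rewrite a0 in L1'; rewrite L1' in lt5.
  have [c0|c0] := eqVneq c 0; last first.
    by rewrite c0 in L2'; rewrite L2' in lt5.
  by rewrite a0 c0; ring.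
have /andP[lts' le5'] := item_leads_lt ne17.
have a0 : a != 0.
  apply/eqP => a0; apply: D; rewrite a0 eqxx /= in L1'.
  have [b0|b0] := eqVneq b 0.
    by move: (leq_trans lts' le5'); rewrite b0 eqxx in L1'; rewrite -L1'.
  rewrite b0 in L1'; move: lts'; rewrite -L1' -L2'.
  have [c0|c0] := eqVneq c 0; last by move=> /(ltn_trans lt12); rewrite ltnn.
  have [d0|d0] := eqVneq d 0; last by rewrite ltnn.
  by rewrite a0 c0; move=> _; ring.
rewrite a0 in L1'.
have c0 : c = 0.
  apply/eqP/negP => /negP c0; rewrite c0 in L2'.
  by move: lts'; rewrite -L2' -L1' /= ltnn.
rewrite c0 eqxx /= in L2'.
have d0 : d != 0 by apply/eqP => d0; apply: D; rewrite d0 c0; ring.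
rewrite d0 in L2'; split; first by rewrite [LHS]surjective_pairing L1' L2' -surjective_pairing.
by exists T1, T0, X0, U0, k, kap, a, b, d, w, w'; rewrite E1 E2 c0.
Qed.

Lemma mulr_eq1_neq0 (x y : R) : x * y = 1 -> y != 0.
Proof.
by move=> xy; apply/eqP => y0; move: xy; rewrite y0 mulr0 => /esym/eqP; rewrite oner_eq0.
Qed.

Lemma jet_equivalent_inj c12 c34 c7 s s' :
  (listed c12 c34 c7 `&` irredundant c7) s -> (listed c12 c34 c7 `&` irredundant c7) s' ->
  jet_equivalent (item_coords s).1 (item_coords s).2 (item_coords s').1 (item_coords s').2 ->
  s = s'.
Proof.
move=> Ls Ls' E.
have [s17|s17] := EM (s = Item17).
  have [s17'|s17'] := EM (s' = Item17); first by rewrite s17.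
  move: E => [T1 [T0 [X0 [U0 [k [kap [a [b [c [d [w [w' [/eqP T10 _ _ E1 _]]]]]]]]]]]]].
  have /andP[lt le5] := item_leads_lt s17'; have [L1' _] := item_leadsE s' w'.
  move: lt; rewrite -L1' E1 lead_jact// s17 /lead /lin /= !mulr0 !addr0 eqxx /=.
  by move=> /leq_trans/(_ le5); rewrite ltnn.
have [Hl [T1 [T0 [X0 [U0 [k [kap [a [b [d [w [w' [T10 k0 d0 E1 E2]]]]]]]]]]]]] :=
  jet_triangular E s17.
(* In families 12 to 16 the second generator is W(1), whose image has derivative coordinate
   [kap * d]. *)
have kap0 : kap * d = 0 -> kap = 0.
  by move=> /eqP; rewrite mulf_eq0 (negPf d0) orbF => /eqP.
have kd0 : k * d != 0 by exact: mulf_neq0.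
case: s s' Ls Ls' Hl E1 E2 {E s17} =>
  [y1 y2 e1 e2|y1 e5|y1|y1 y2 e5|y1 y2|y1 e1 e2|y1 e1 e2 e3 e4|e1 e2 e5|e1 e2 e3 e4
  |e1 e2|e1 e2|y1 y2 y3|y2 y3 e5|e1 e2|e1 e2|y3|]
  [z1 z2 f1 f2|z1 f5|z1|z1 z2 f5|z1 z2|z1 f1 f2|z1 f1 f2 f3 f4|f1 f2 f5|f1 f2 f3 f4
  |f1 f2|f1 f2|z1 z2 z3|z2 z3 f5|f1 f2|f1 f2|z3|] //= [Ls irs] [Ls' irs'] _;
  rewrite /jet /jact /lin /= => -[Ed Eg Ep Ex Ev EA EB] [Fd Fg Fp Fx Fv FA FB].
- have [a1 b0] : a = 1 /\ b = 0 by lra.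
  subst a b; have d1 : d = 1 by lra.
  subst d; have [-> ->] : z1 = y1 /\ z2 = y2 by lra.
  have f1E : f1 = k * e1 by lra.
  have f2E : f2 = k * e2 by lra.
  by move: Ls'; rewrite f1E f2E => /(normalized_inj k0 Ls)[-> ->].
- have a1 : a = 1 by lra.
  subst a; have -> : z1 = y1 by lra.
  have f5E : f5 = k * e5 by lra.
  by move: Ls'; rewrite f5E => /(bit_inj k0 Ls) ->.
(* Families 2 and 3 share their pivots, as do 4 and 5; they differ in whether the second w-component
   vanishes. *)
- by exfalso; lra.
- by case/eqP: kd0; lra.
- have a1 : a = 1 by lra.
  by subst a; congr Item3; lra.
- have a1 : a = 1 by lra.
  subst a; have -> : z1 = y1 by lra.
  have -> : z2 = y2 by lra.
  have f5E : f5 = k * e5 by lra.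
  by move: Ls'; rewrite f5E => /(bit_inj k0 Ls) ->.
- by exfalso; lra.
- by case/eqP: kd0; lra.
- have a1 : a = 1 by lra.
  by subst a; congr Item5; lra.
- have [a1 b0] : a = 1 /\ b = 0 by lra.
  subst a b; have d1 : d = 1 by lra.
  subst d; have -> : z1 = y1 by lra.
  have f1E : f1 = k * e1 by lra.
  have f2E : f2 = k * e2 by lra.
  by move: Ls'; rewrite f1E f2E => /(normalized_inj k0 Ls)[-> ->].
(* Family 7: [b] is the shift of [reduced_inj], and [d] is forced to be 1 when [e4] is nonzero. *)
- have a1 : a = 1 by lra.
  subst a; have Td : T1 * d = 1 by lra.
  have f3E : f3 = T1 * e3 by lra.
  have f4E : f4 = d * e4 by lra.
  have z1E : z1 = 1 * (y1 + b * e4) by lra.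
  have f1E : f1 = k * (e1 + b * e2) by lra.
  have f2E : f2 = k * d * e2 by lra.
  case: Ls Ls' => n12 n34 red [n12' + red'].
  rewrite f3E f4E => /(normalized_hyperbolic_inj Td n34)[e3E e4E d1].
  rewrite z1E f1E f2E f4E in red'.
  have [|z1y1 [h h0 [h1 h2]]] := reduced_inj (oner_neq0 R) k0 kd0 d0 _ red red'.
    by move=> /d1 ->; rewrite mulr1.
  rewrite z1E z1y1 mul1r e3E e4E f1E f2E h1 h2 in n12' *.
  by have [-> ->] := normalized_inj h0 n12 n12'.
- have [a1 b0] : a = 1 /\ b = 0 by lra.
  subst a b; have d1 : d = 1 by lra.
  subst d; case: Ls Ls' => n12 b5 [+ +].
  have f5E : f5 = T1 * e5 by lra.
  have f1E : f1 = k * e1 by lra.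
  have f2E : f2 = k * e2 by lra.
  rewrite f5E f1E f2E => /(normalized_inj k0 n12)[-> ->].
  by move=> /(bit_inj T10 b5) ->.
(* Family 9: both rows are scaled by 1 / T1, and writing [b] as [d * s] exhibits the shift of
   [reduced_inj]. *)
- have Ta : T1 * a = 1 by lra.
  have Td : T1 * d = 1 by lra.
  have ad : a = d by apply: (mulfI T10); rewrite Ta Td.
  subst a; set s := T1 * b.
  have bE : b = d * s by rewrite /s mulrA [d * _]mulrC Td mul1r.
  have f3E : f3 = d * (e3 + s * e4) by rewrite -[s * _]/(s * e4); rewrite bE in Ev; lra.
  have f4E : f4 = d * e4 by lra.
  have f1E : f1 = k * d * (e1 + s * e2) by rewrite bE in EB; lra.
  have f2E : f2 = k * d * e2 by lra.
  case: Ls Ls' => n12 n34 [n12' n34'].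
  rewrite f1E f2E f3E f4E in irs' n12' n34' *.
  have [//|r3 [h h0 [h1 h2]]] := reduced_inj d0 kd0 kd0 d0 _ irs irs'.
  rewrite r3 h1 h2 in n12' n34' *.
  have [-> ->] := normalized_inj h0 n12 n12'.
  by have [-> ->] := normalized_inj d0 n34 n34'.
- have Ta : T1 * a = 1 by lra.
  have b0 : b = 0 by lra.
  have d1 : d = 1 by lra.
  subst b d; have f1E : f1 = k * a * e1 by lra.
  have f2E : f2 = k * e2 by lra.
  move: irs irs'; rewrite f1E f2E => -[b1 b2] [].
  have ka0 : k * a != 0 by rewrite mulf_neq0// (mulr_eq1_neq0 Ta).
  by move=> /(bit_inj ka0 b1) -> /(bit_inj k0 b2) ->.
- have Ta : T1 * a = 1 by lra.
  have b0 : b = 0 by lra.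
  have d1 : d = 1 by lra.
  subst b d; have f1E : f1 = k * a * e1 by lra.
  have f2E : f2 = k * e2 by lra.
  move: irs irs'; rewrite f1E f2E => -[b1 b2] [].
  have ka0 : k * a != 0 by rewrite mulf_neq0// (mulr_eq1_neq0 Ta).
  by move=> /(bit_inj ka0 b1) -> /(bit_inj k0 b2) ->.
- have kap00 : kap = 0 by apply: kap0; lra.
  have a1 : a = 1 by lra.
  by subst a kap; congr Item12; lra.
- have kap00 : kap = 0 by apply: kap0; lra.
  have a1 : a = 1 by lra.
  subst a kap; have f5E : f5 = T1 * e5 by lra.
  have -> : z2 = y2 by lra.
  have -> : z3 = y3 by lra.
  by move: Ls'; rewrite f5E => /(bit_inj T10 Ls) ->.
- have kap00 : kap = 0 by apply: kap0; lra.
  have Ta : T1 * a = 1 by lra.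
  subst kap; have f1E : f1 = a * e1 by lra.
  have f2E : f2 = a * e2 by lra.
  by move: Ls'; rewrite f1E f2E => /(normalized_inj (mulr_eq1_neq0 Ta) Ls)[-> ->].
- have kap00 : kap = 0 by apply: kap0; lra.
  have Ta : T1 * a = 1 by lra.
  subst kap; have f1E : f1 = a * e1 by lra.
  have f2E : f2 = a * e2 by lra.
  by move: Ls'; rewrite f1E f2E => /(normalized_inj (mulr_eq1_neq0 Ta) Ls)[-> ->].
- have kap00 : kap = 0 by apply: kap0; lra.
  have a1 : a = 1 by lra.
  by subst a kap; congr Item16; lra.
Qed.

End Uniqueness.

(** * Representatives of the listed items that are not irredundant *)

Section Redundancy.
Variables (R : realType) (c12 c34 c7 : bool).

Lemma eqv_refl (r1 r2 : coords R) : eqv r1 r2 r1 r2.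
Proof.
exists 1, 0, 0, 0, 1, 0, 1, 0, 0, 1; split; try exact/eqP/oner_neq0.
- by rewrite mulr0 subr0 mulr1; exact/eqP/oner_neq0.
- by case: r1 => *; rewrite /lin /act /=; congr Coords; ring.
- by case: r2 => *; rewrite /lin /act /=; congr Coords; ring.
Qed.

(** Only families 9 to 11 carry an irredundancy condition; every other listed item represents
    itself. *)
Lemma listed_reaches (s : item R) : listed c12 c34 c7 s ->
  reaches c12 c34 c7 (item_family s) (item_coords s).1 (item_coords s).2.
Proof.
case: s => *; try by eexists; split; try exact: eqv_refl.
- exact: reaches9.
- exact: reaches10.
- exact: reaches11.
Qed.

Lemma eqv_item_equivalent (s s' : item R) I : open_interval I ->
  eqv (item_coords s).1 (item_coords s).2 (item_coords s').1 (item_coords s').2 ->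
  exists2 J, open_interval J & equivalent I J (item_span s I) (item_span s' J).
Proof.
move=> oI; have [opI _ _] := oI; rewrite item_spanE => e.
suff [J oJ eqJ] : exists2 J, open_interval J & equivalent I J
    (span2 I (vfc (item_coords s).1) (vfc (item_coords s).2))
    (span2 J (vfc (item_coords s').1) (vfc (item_coords s').2)).
  by exists J; rewrite ?item_spanE.
move: (item_coords s).1 (item_coords s).2 e
  => [d1 g1 p1 x1 v1 A1 B1] [d2 g2 p2 x2 v2 A2 B2] e.
(* The w-components of an item are affine already, so the identity rectifies them. *)
apply: (@eqv_equivalent R I _ _ _ d1 g1 p1 x1 v1 d2 g2 p2 x2 v2
  (fun w => A1 * w + B1) (fun w => A2 * w + B2) id _ _ _ _ _ _ oI erefl) e => //.
- exact: smooth_id.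
- by move=> w _; rewrite derive1_id; exact/eqP/oner_neq0.
- by move=> w _; rewrite derive1_id mul1r.
- by move=> w _; rewrite derive1_id mul1r.
Qed.

End Redundancy.

Theorem theorem14 (R : realType) (c12 c34 c7 : bool) :
  optimal_list2 (@item_span R) (listed c12 c34 c7 `&` irredundant c7) /\
  (forall (s : item R) (I : set R), listed c12 c34 c7 s -> open_interval I ->
     exists (s' : item R) (J : set R),
       [/\ listed c12 c34 c7 s', irredundant c7 s', item_family s' = item_family s,
           open_interval J & equivalent I J (item_span s I) (item_span s' J)]).
Proof.
split; [split|].
- by move=> s I _; exact: item_subalgebra.
- move=> s s' I J Ls Ls' oI _ /(equivalent_jet oI).
  exact: jet_equivalent_inj Ls Ls'.
- by move=> I S; exact: exhaustive.
- move=> s I /listed_reaches[s' [Ls' irs' fam e]] oI.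
  by have [J oJ eqJ] := eqv_item_equivalent oI e; exists s', J.
Qed.
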